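(* (Double disk flipping.) Let $F$ be a closed $GL(2)$ foam with a double facet that is a disk $D^2$ bounding a singular circle, and suppose $D^2$ can be completed to a $2$-sphere $\mathbb{S}^2\subset\mathbb{R}^3$ without additional intersections with $F$, the complementary disk $\mathbb{S}^2\setminus D^2$ approaching the singular circle from the side of the thin surface opposite to $D^2$. Let $F_1$ be the foam obtained from $F$ by removing the disk $D^2$ and adding instead, as a double facet, its complement in $\mathbb{S}^2$. Then $\langle F\rangle=-\langle F_1\rangle$.
   Context: $\mathbf{k}=\mathbb{Z}[\beta_{k,\ell}:k,\ell\ge0,(k,\ell)\ne(0,0)]$; $p(x,y)=1+\sum\beta_{k,\ell}x^ky^\ell$; $p_{12}=p(x_1,x_2)$, $p_{21}=p(x_2,x_1)$. A closed $GL(2)$ foam $F$ is a compact two-dimensional combinatorial CW-complex embedded in $\mathbb{R}^3$ whose only singularities are singular circles, with neighbourhood $\mathbb{S}^1\times$tripod; facets are thin or double, and along each singular circle two thin facets and one double facet meet. Facets are oriented so that at each singular circle the orientation of each adjacent thin facet agrees with that of the double facet across the circle; the circle is oriented by $t$, where $(v,t)$ is an oriented basis coming from a thin facet with $v$ pointing into the double facet. Thin facets may carry dots. In $F_1$ the thin facets, their orientations and dots, and the orientation of the singular circle are those of $F$. A coloring $c$ maps thin facets to $\{1,2\}$ so that the two thin facets at each singular circle have different colors; double facets are colored $\{1,2\}$. $F_i(c)$ is the union of closed facets whose color is or contains $i$; $\chi_i(c)=\chi(F_i(c))$; $F_{12}$ (the thin surface) is the union of thin facets; $d_i(c)$ is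 the number of dots on facets colored $i$; $\theta^+(c)$ is the number of positive singular circles, where a circle is positive if, looking in the direction of its orientation, the first thin facet met counterclockwise starting from the double facet is colored $1$. Evaluation: $\langle F\rangle=\sum_c\langle F,c\rangle$ over all colorings, with $$\langle F,c\rangle=(-1)^{\theta^+(c)+\chi_2(c)/2}\,\frac{x_1^{d_1(c)}x_2^{d_2(c)}p_{12}^{\chi_1(c)/2}p_{21}^{\chi_2(c)/2}}{(x_1-x_2)^{\chi(F_{12})/2}}\in\mathbf{k}\llbracket x_1,x_2\rrbracket\Bigl[\tfrac1{x_1-x_2}\Bigr].$$ *)

(* Defs.v *)
From HB Require Import structures.
From mathcomp Require Import all_boot all_order all_algebra.
From mathcomp Require Import finmap.
From mathcomp Require Import monalg.
From mathcomp Require Import boolp reals.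

Set Implicit Arguments.
Unset Strict Implicit.
Unset Printing Implicit Defensive.

Import Order.TTheory GRing.Theory Num.Theory.
Local Open Scope ring_scope.

(* Formal power series in one variable; [fps (fps k)] is k[[x1, x2]], with x1
   the outer variable. *)
Record fps (R : Type) := Fps { fps_coef : nat -> R }.

HB.instance Definition _ (R : Type) := gen_eqMixin (fps R).
HB.instance Definition _ (R : Type) := gen_choiceMixin (fps R).

Lemma fps_ext (R : Type) (f g : fps R) : fps_coef f =1 fps_coef g -> f = g.
Proof. by case: f g => [f] [g] /= /funext ->. Qed.

Section FpsZmod.
Variable R : zmodType.
Implicit Types f g : fps R.

Definition fps_zero : fps R := Fps (fun=> 0).
Definition fps_opp f := Fps (fun n => - fps_coef f n).
Definition fps_add f g := Fps (fun n => fps_coef f n + fps_coef g n).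

Fact fps_addA : associative fps_add.
Proof. by move=> f g h; apply: fps_ext => n /=; rewrite addrA. Qed.
Fact fps_addC : commutative fps_add.
Proof. by move=> f g; apply: fps_ext => n /=; rewrite addrC. Qed.
Fact fps_add0 : left_id fps_zero fps_add.
Proof. by move=> f; apply: fps_ext => n /=; rewrite add0r. Qed.
Fact fps_addN : left_inverse fps_zero fps_opp fps_add.
Proof. by move=> f; apply: fps_ext => n /=; rewrite addNr. Qed.

HB.instance Definition _ :=
  GRing.isZmodule.Build (fps R) fps_addA fps_addC fps_add0 fps_addN.
End FpsZmod.

Section FpsRing.
Variable R : comNzRingType.
Implicit Types f g h : fps R.

Definition fps_const (c : R) : fps R := Fps (fun n => if n == 0%N then c else 0).
Definition fps_mul f g : fps R :=
  Fps (fun n => \sum_(i < n.+1) fps_coef f i * fps_coef g (n - i)).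

Let trunc m f : {poly R} := \poly_(i < m.+1) fps_coef f i.

Let trunc_mul m f g n : (n <= m)%N ->
  fps_coef (fps_mul f g) n = (trunc m f * trunc m g)`_n.
Proof.
move=> le_nm; rewrite coefM /=; apply: eq_bigr => i _.
rewrite !coef_poly !ltnS (leq_trans (leq_subr _ _) le_nm).
by rewrite (leq_trans _ le_nm) // -ltnS.
Qed.

Fact fps_mulA : associative fps_mul.
Proof.
move=> f g h; apply: fps_ext => n.
transitivity ((trunc n f * (trunc n g * trunc n h))`_n).
  rewrite coefM [LHS]/fps_coef /=; apply: eq_bigr => i _.
  rewrite coef_poly ltn_ord; congr (_ * _).
  exact: (trunc_mul _ _ (leq_subr i n)).
rewrite mulrA coefM [RHS]/fps_coef /=; apply: eq_bigr => i _.
rewrite [X in _ * X]coef_poly ltnS leq_subr; congr (_ * _).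
by apply/esym/trunc_mul; rewrite -ltnS.
Qed.

Fact fps_mulC : commutative fps_mul.
Proof.
by move=> f g; apply: fps_ext => n; rewrite !(@trunc_mul n) // mulrC.
Qed.

Fact fps_mul1 : left_id (fps_const 1) fps_mul.
Proof.
move=> f; apply: fps_ext => n /=; rewrite big_ord_recl /= subn0 mul1r big1 ?addr0 //.
by move=> i _; rewrite mul0r.
Qed.

Fact fps_mulD : left_distributive fps_mul (@fps_add R).
Proof.
move=> f g h; apply: fps_ext => n /=; rewrite -big_split /=.
by apply: eq_bigr => i _; rewrite mulrDl.
Qed.

Fact fps_1neq0 : fps_const 1 != 0.
Proof.
by apply/eqP => /(congr1 (fun f => fps_coef f 0)) /eqP; rewrite /= oner_eq0.
Qed.

HB.instance Definition _ := GRing.Zmodule_isComNzRing.Build (fps R)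
  fps_mulA fps_mulC fps_mul1 fps_mulD fps_1neq0.

Lemma fps_coefM f g n :
  fps_coef (f * g) n = \sum_(i < n.+1) fps_coef f i * fps_coef g (n - i).
Proof. by []. Qed.

Lemma fps_coefB f g n : fps_coef (f - g) n = fps_coef f n - fps_coef g n.
Proof. by []. Qed.

End FpsRing.

(* k = Z[beta_(k,l)], as the monoid algebra over Z of the free commutative
   monoid on the indices (k, l) <> (0, 0). *)
Definition beta_index := {kl : nat * nat | kl != (0%N, 0%N)}.

Definition kk := {malg int[{cmonom beta_index}]}.
HB.instance Definition _ := GRing.ComNzRing.on kk.

(* Coefficient of x^k y^l in p(x, y). *)
Definition p_coef (k l : nat) : kk :=
  if insub (k, l) is Some i then << ucm (i : beta_index) >> else 1.

Definition kxx := fps (fps kk).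
HB.instance Definition _ := GRing.ComNzRing.on kxx.

(* The power series with a i j as coefficient of x1^i x2^j. *)
Definition series (a : nat -> nat -> kk) : kxx := Fps (fun i => Fps (a i)).

Definition x1 : kxx := series (fun i j => ((i == 1%N) && (j == 0%N))%:R).
Definition x2 : kxx := series (fun i j => ((i == 0%N) && (j == 1%N))%:R).
Definition p12 : kxx := series (fun i j => p_coef i j).
Definition p21 : kxx := series (fun i j => p_coef j i).

(* The localization A[1/s] is A['X] / (s 'X - 1), for s not nilpotent. *)
Section Localization.
Variables (A : comNzRingType) (s : A) (s_reg : forall n, s ^+ n != 0).

Definition loc_ideal : {pred {poly A}} :=
  fun q => `[< exists r : {poly A}, q = r * (s *: 'X - 1) >].

Fact loc_idealr_closed : idealr_closed loc_ideal.
Proof.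
split; first by apply/asboolP; exists 0; rewrite mul0r.
- apply/asboolP => -[r /esym r_inv].
  have r_coef n : r`_n = - s ^+ n.
    elim: n => [|n IHn].
      move/(congr1 (fun q : {poly A} => q`_0)): r_inv.
      rewrite coef1 /= mulrBr mulr1 coefB -scalerAr coefZ coefMX mulr0 add0r.
      by move/(canRL (@opprK _)).
    move/(congr1 (fun q : {poly A} => q`_n.+1)): r_inv.
    rewrite coef1 /= mulrBr mulr1 coefB -scalerAr coefZ coefMX /= IHn.
    by move/eqP; rewrite subr_eq0 => /eqP <-; rewrite mulrN exprS.
  have := r_coef (size r); rewrite nth_default // => /eqP.
  by rewrite eq_sym oppr_eq0 (negPf (s_reg _)).
move=> a u v /asboolP[r ->] /asboolP[t ->]; apply/asboolP.
by exists (a * r + t); rewrite mulrDl mulrA.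
Qed.

End Localization.

Definition s12 : kxx := x1 - x2.

Fact s12_not_nilpotent n : s12 ^+ n != 0.
Proof.
suff H : fps_coef (fps_coef (s12 ^+ n) n) 0 = 1.
  by apply/eqP => E; move/eqP: H; rewrite E /= eq_sym oner_eq0.
elim: n => [//|n IHn]; rewrite exprS.
have coef0_sum m (F : 'I_m -> fps kk) :
    fps_coef (\sum_i F i) 0 = \sum_i fps_coef (F i) 0.
  by apply: (big_morph (fun u => fps_coef u 0)).
rewrite fps_coefM coef0_sum; under eq_bigr do rewrite fps_coefM big_ord1 !fps_coefB.
rewrite big_ord_recl big_ord_recl /= subn1 /= IHn big1 => [|i _].
  by rewrite subrr mul0r add0r subr0 mulr1 addr0.
by rewrite subrr mul0r.
Qed.

(* kloc is k[[x1, x2]][1 / (x1 - x2)]; its units and inverses are those of the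
   ring, so that [^] is the genuine integer power at x1 - x2, p12 and p21. *)
Definition loc12 := loc_ideal s12.
HB.instance Definition _ := isIdealr.Build {poly kxx} loc12
  (loc_idealr_closed s12_not_nilpotent).
Definition kloc := {ideal_quot loc12}.
HB.instance Definition _ := GRing.ComNzRing.on kloc.

Definition loc_unit : {pred kloc} := fun a => `[< exists b : kloc, b * a = 1 >].
Definition loc_inv (a : kloc) : kloc :=
  if pselect (exists b : kloc, b * a = 1) is left h then projT1 (cid h) else a.

Fact loc_mulVx : {in loc_unit, left_inverse 1 loc_inv *%R}.
Proof.
move=> a /asboolP ua; rewrite /loc_inv; case: pselect => // h; exact: projT2 (cid h).
Qed.
Fact loc_unitPl (a b : kloc) : b * a = 1 -> loc_unit a.
Proof. by move=> ba; apply/asboolP; exists b. Qed.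
Fact loc_invr_out : {in [predC loc_unit], loc_inv =1 id}.
Proof. by move=> a /asboolP ua; rewrite /loc_inv; case: pselect. Qed.

HB.instance Definition _ := GRing.ComNzRing_hasMulInverse.Build kloc
  loc_mulVx loc_unitPl loc_invr_out.

Definition to_kloc (f : kxx) : kloc := (\pi_kloc (f%:P))%qT.

Fact to_kloc_monoid : monoid_morphism to_kloc.
Proof.
split=> [|f g]; rewrite /to_kloc ?polyCM.
  exact: (rmorph1 (\pi_kloc)%qT).
exact: (rmorphM (\pi_kloc)%qT).
Qed.

Fact s12_unit : to_kloc s12 \is a GRing.unit.
Proof.
apply/asboolP; exists (\pi_kloc 'X)%qT.
apply/eqP; rewrite /to_kloc -rmorphM -[1](rmorph1 (\pi_kloc)%qT) /=.
rewrite -Quotient.idealrBE; apply/asboolP; exists 1.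
by rewrite mul1r mulrC mul_polyC.
Qed.

Fact fps_invl (R : comNzRingType) (f : fps R) (b : R) :
  b * fps_coef f 0 = 1 -> exists g : fps R, g * f = 1.
Proof.
move=> bf.
pose fix invs n : seq R := if n is m.+1 then
  rcons (invs m)
    (b * ((m == 0%N)%:R - \sum_(i < m) (invs m)`_i * fps_coef f (m - i)))
  else [::].
have size_invs n : size (invs n) = n by elim: n => //= n IHn; rewrite size_rcons IHn.
have invsE m n : (n < m)%N -> (invs m)`_n = (invs n.+1)`_n.
  elim: m => // m IHm; rewrite ltnS leq_eqVlt => /predU1P[-> //|lt_nm].
  by rewrite -(IHm lt_nm) /= nth_rcons size_invs lt_nm.
exists (Fps (fun n => (invs n.+1)`_n)); apply: fps_ext => n.
rewrite [LHS]/fps_coef /= big_ord_recr /= subnn.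
rewrite nth_rcons size_invs ltnn eqxx mulrAC bf mul1r.
under eq_bigr => i _ do rewrite -[rcons _ _]/(invs i.+1) -(invsE n) //.
rewrite addrC subrK.
by case: n.
Qed.

Fact p_unit (a : nat -> nat -> kk) : a 0%N 0%N = 1 ->
  to_kloc (series a) \is a GRing.unit.
Proof.
move=> a1.
have [b ba] : exists b : fps kk, b * fps_coef (series a) 0 = 1.
  by apply: (@fps_invl _ _ 1); rewrite mul1r.
have [g ga] := @fps_invl _ (series a) b ba.
apply/asboolP; exists (to_kloc g).
by rewrite -to_kloc_monoid.2 -to_kloc_monoid.1; congr to_kloc.
Qed.

Fact p12_unit : to_kloc p12 \is a GRing.unit.
Proof. by apply: p_unit; rewrite /p_coef insubF. Qed.

Fact p21_unit : to_kloc p21 \is a GRing.unit.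
Proof. by apply: p_unit; rewrite /p_coef insubF. Qed.

(* A finite simplicial complex is the set of its nonempty simplices, each a set
   of vertices; a pure complex is also given by its top simplices X, and then
   is [faces X]. *)
Section Complexes.
Variable T : finType.
Implicit Types (K X : {set {set T}}) (s : {set T}).

Definition faces X : {set {set T}} :=
  [set s | (s != set0) && [exists t in X, s \subset t]].

Definition euler K : int := \sum_(s in K) (-1) ^+ #|s|.-1.

(* Stellar subdivision of K at s with new vertex w: the open star of s is
   replaced with the cone from w over its boundary. *)
Definition stellar K s (w : T) : {set {set T}} :=
  [set t in K | ~~ (s \subset t)]
  :|: [set w |: t | t in [set t : {set T} | ~~ (s \subset t) & t :|: s \in K]].

Definition stellar_move : rel {set {set T}} := fun K L =>
  [exists s in K, exists w, (w \notin cover K) && (L == stellar K s w)].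

Definition stellar_equiv : rel {set {set T}} :=
  connect [rel K L | stellar_move K L || stellar_move L K].

End Complexes.

(* Combinatorial (equivalently, by Alexander's theorem, PL) homeomorphism: after
   embedding the vertices in a large enough common set, a finite chain of
   stellar subdivisions and inverses. *)
Definition comb_homeo (T U : finType) (K : {set {set T}}) (L : {set {set U}}) :
    Prop :=
  exists (W : finType) (f : T -> W) (g : U -> W),
    [/\ injective f, injective g &
      stellar_equiv [set f @: s | s : {set T} in K]
                    [set g @: s | s : {set U} in L]].

Definition is_disk (T : finType) (K : {set {set T}}) : Prop :=
  comb_homeo K [set s : {set 'I_3} | s != set0].

Definition is_sphere (T : finType) (K : {set {set T}}) : Prop :=
  comb_homeo K [set s : {set 'I_4} | s != set0 & s != setT].

Section Geometry.
Variables (R : realType) (T : finType) (pos : T -> 'rV[R]_3).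
Implicit Types (K : {set {set T}}) (s : {set T}).

Definition hull s (x : 'rV[R]_3) : Prop :=
  exists a : T -> R, [/\ forall v, v \in s -> 0 <= a v,
    \sum_(v in s) a v = 1 & x = \sum_(v in s) a v *: pos v].

Definition aff_indep s : Prop := forall a : T -> R,
  \sum_(v in s) a v = 0 -> \sum_(v in s) a v *: pos v = 0 ->
  forall v, v \in s -> a v = 0.

Definition polyhedron K (x : 'rV[R]_3) : Prop := exists2 s, s \in K & hull s x.

Definition embedded K : Prop :=
  (forall s, s \in K -> aff_indep s) /\
  (forall s t, s \in K -> t \in K ->
     forall x, hull s x -> hull t x -> hull (s :&: t) x).

Definition turn (p q a b : T) : bool :=
  0 < \det (\matrix_(i < 3) [:: pos q - pos p; pos a - pos p; pos b - pos p]`_i).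

(* For half-planes bounded by the line pq and containing a, b, c: rotating about
   the vector from p to q by the right-hand rule, one meets them in the cyclic
   order a, b, c.  The three successive angles add up to 2 pi, so this holds
   when at least two of them have a positive sine, and the opposite order when
   at least two have a negative sine. *)
Definition rot_order (p q a b c : T) : bool :=
  (2 <= turn p q a b + turn p q b c + turn p q c a)%N.

(* Looking from p towards q, the first of a, b met counterclockwise starting
   from d is a.  For a viewer looking along its axis, a right-handed rotation is
   clockwise, hence the reversal. *)
Definition first_ccw (p q d a b : T) : bool := rot_order p q d b a.

End Geometry.

(* The data of a triangulated foam: its triangles, those lying on thin facets
   (all others lying on double facets), an orientation of the triangles, where
   [ori a b c] means that a, b, c is a positive ordering of the triangle abc,
   and the number of dots on each thin facet.  A facet is given by its set of
   triangles. *)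
Record prefoam (T : finType) := Prefoam {
  triangles : {set {set T}};
  thin : {set {set T}};
  ori : T -> T -> T -> bool;
  dots : {set {set T}} -> nat
}.

Section Foam.
Variables (T : finType) (F : prefoam T).
Implicit Types (s t e : {set T}) (f C : {set {set T}}).

Definition star s : {set {set T}} := [set t in triangles F | s \subset t].

Definition edges : {set {set T}} := [set e in faces (triangles F) | #|e| == 2].
Definition regular_edges : {set {set T}} := [set e in edges | #|star e| == 2].
Definition singular_edges : {set {set T}} := [set e in edges | #|star e| == 3].

Definition facet_adj : rel {set T} := fun s t =>
  [exists e in regular_edges, (s \in star e) && (t \in star e)].

Definition facets : {set {set {set T}}} :=
  equivalence_partition (connect facet_adj) (triangles F).

Definition facet_of t : {set {set T}} := pblock facets t.

Definition thin_facets : {set {set {set T}}} :=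
  [set f in facets | f \subset thin F].
Definition double_facets : {set {set {set T}}} :=
  [set f in facets | [disjoint f & thin F]].

(* Triangles at the vertex v in the same local sheet of F at v. *)
Definition same_sheet (v : T) : rel {set T} :=
  connect (fun s t => [exists e in regular_edges,
    [&& v \in e, s \in star e & t \in star e]]).

Definition singular_at (v : T) : {set {set T}} :=
  [set e in singular_edges | v \in e].

(* Around v, F is a disk. *)
Definition regular_vertex (v : T) : Prop :=
  singular_at v = set0 /\
  forall s t, s \in star [set v] -> t \in star [set v] -> same_sheet v s t.

(* Around v, F is an interval times a tripod: three sheets, each running from
   the singular edge va to the singular edge vb. *)
Definition singular_vertex (v : T) : Prop :=
  exists a b : T, [/\ a != b, singular_at v = [set [set v; a]; [set v; b]] &
    forall s, s \in star [set v] ->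
      (exists2 t, t \in star [set v; a] & same_sheet v s t) /\
      (exists2 t, t \in star [set v; b] & same_sheet v s t)].

Definition circle_adj : rel {set T} := fun e e' =>
  [&& e \in singular_edges, e' \in singular_edges & ~~ [disjoint e & e']].

(* A singular circle is given by its set of edges. *)
Definition circles : {set {set {set T}}} :=
  equivalence_partition (connect circle_adj) singular_edges.

(* Color 1 is [true] and color 2 is [false]; outside the thin facets, where it
   is irrelevant, a coloring is normalized to [true]. *)
Definition is_coloring (c : {ffun {set {set T}} -> bool}) : bool :=
  (c \in pffun_on true (mem thin_facets) predT) &&
  [forall e in singular_edges, forall s in star e :&: thin F,
     forall t in star e :&: thin F,
     (s != t) ==> (c (facet_of s) != c (facet_of t))].

End Foam.

Section Embedded_foam.
Variables (R : realType) (T : finType) (pos : T -> 'rV[R]_3) (F : prefoam T).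

(* A closed GL(2) foam in R^3.  The last condition is part of the requirement
   that the singular circles have neighbourhoods S^1 x tripod in R^3: the three
   sheets come in the same cyclic order along a circle, here on two successive
   edges av and vb. *)
Record is_foam : Prop := IsFoam {
  foam_triangles : forall t, t \in triangles F -> #|t| = 3;
  foam_embedded : embedded pos (faces (triangles F));
  foam_edges : forall e, e \in edges F ->
    (e \in regular_edges F) || (e \in singular_edges F);
  foam_vertices : forall v, v \in cover (triangles F) ->
    regular_vertex F v \/ singular_vertex F v;
  foam_thin : thin F \subset triangles F;
  foam_regular_edges : forall e s t, e \in regular_edges F ->
    s \in star F e -> t \in star F e -> (s \in thin F) = (t \in thin F);
  foam_singular_edges : forall e, e \in singular_edges F ->
    #|star F e :&: thin F| = 2;
  foam_ori : forall a b c, [set a; b; c] \in triangles F ->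
    ori F a b c = ori F b c a /\ ori F a b c = ~~ ori F b a c;
  foam_ori_regular : forall a b c d, [set a; b] \in regular_edges F ->
    c != d -> [set a; b; c] \in triangles F -> [set a; b; d] \in triangles F ->
    ori F a b c = ~~ ori F a b d;
  foam_ori_singular : forall a b c d, [set a; b] \in singular_edges F ->
    [set a; b; c] \in thin F -> [set a; b; d] \in triangles F :\: thin F ->
    ori F a b c = ~~ ori F a b d;
  foam_cyclic : forall v a b x y z x' y' z', a != b ->
    [set a; v] \in singular_edges F -> [set v; b] \in singular_edges F ->
    star F [set a; v] = [set [set a; v; x]; [set a; v; y]; [set a; v; z]] ->
    star F [set v; b] = [set [set v; b; x']; [set v; b; y']; [set v; b; z']] ->
    same_sheet F v [set a; v; x] [set v; b; x'] ->
    same_sheet F v [set a; v; y] [set v; b; y'] ->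
    same_sheet F v [set a; v; z] [set v; b; z'] ->
    rot_order pos a v x y z = rot_order pos v b x' y' z'
}.

Variable c : {ffun {set {set T}} -> bool}.

Definition colored_surface (i : bool) : {set {set T}} :=
  faces (cover [set f in facets F | (f \in double_facets F) || (c f == i)]).

Definition chi (i : bool) : int := euler (colored_surface i).

Definition chi12 : int := euler (faces (thin F)).

Definition ndots (i : bool) : nat :=
  \sum_(f in thin_facets F | c f == i) dots F f.

(* At a singular edge pq, let v be tangent to an adjacent thin triangle pqa and
   point out of it, into the double facet.  If p, q, a is a positive ordering,
   then v followed by the vector from p to q is an oriented basis: the edge is
   oriented from p to q. *)
Definition positive (C : {set {set T}}) : bool :=
  [forall p, forall q, forall d, forall a, forall b,
     [&& [set p; q] \in C, [set p; q; d] \in triangles F :\: thin F,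
         [set p; q; a] \in thin F, [set p; q; b] \in thin F, a != b,
         ori F p q a & first_ccw pos p q d a b]
     ==> c (facet_of F [set p; q; a])].

Definition theta : nat := #|[set C in circles F | positive C]|.

(* The Euler characteristics halved here are even: the surfaces are closed
   surfaces embedded in R^3. *)
Definition color_eval : kloc :=
  (-1) ^ (theta%:Z + (chi false %/ 2)%Z)
  * (to_kloc x1 ^+ ndots true * to_kloc x2 ^+ ndots false
     * to_kloc p12 ^ (chi true %/ 2)%Z * to_kloc p21 ^ (chi false %/ 2)%Z)
  / (to_kloc (x1 - x2)) ^ (chi12 %/ 2)%Z.

End Embedded_foam.

Definition foam_eval (R : realType) (T : finType) (pos : T -> 'rV[R]_3)
    (F : prefoam T) : kloc :=
  \sum_(c | is_coloring F c) color_eval pos F c.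

(* The triangles S form a 2-sphere in R^3 that completes the double facet D and
   has no other intersection with F, and S \ D approaches the singular circle C
   from the side of the thin surface opposite to D. *)
Record completes_disk (R : realType) (T : finType) (pos : T -> 'rV[R]_3)
    (F : prefoam T) (D C S : {set {set T}}) : Prop := CompletesDisk {
  sphere_triangles : forall t, t \in S -> #|t| = 3;
  sphere_embedded : embedded pos (faces S);
  sphere_sphere : is_sphere (faces S);
  sphere_disk : D \subset S;
  sphere_meets : forall x, polyhedron pos (faces S) x ->
    polyhedron pos (faces (triangles F)) x -> polyhedron pos (faces D) x;
  sphere_side : forall p q a b d d', [set p; q] \in C ->
    [set p; q; a] \in thin F -> [set p; q; b] \in thin F -> a != b ->
    [set p; q; d] \in D -> [set p; q; d'] \in S :\: D ->
    rot_order pos p q a d b != rot_order pos p q a d' b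
}.

(* F1 is F with the double facet D replaced with S \ D.  The orientation of the
   new double facet is left to the condition that F1 be a foam. *)
Record disk_flip (T : finType) (F : prefoam T) (D S : {set {set T}})
    (F1 : prefoam T) : Prop := DiskFlip {
  flip_triangles : triangles F1 = (triangles F :\: D) :|: (S :\: D);
  flip_thin : thin F1 = thin F;
  flip_ori : forall a b c, [set a; b; c] \in triangles F :\: D ->
    ori F1 a b c = ori F a b c;
  flip_dots : forall f, f \in thin_facets F -> dots F1 f = dots F f
}.

(* Main.v *)
(* F and F1 have the same thin facets, singular circles and colorings, so the
   evaluations are compared coloring by coloring.  The surface F_i(c) changes by
   trading the disk D for S \ D, glued along the same circle C; as chi(C) = 0,
   chi(S \ D) = chi(S) - chi(D) = 1 = chi(D) and chi_i(c) does not change.  The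
   only sign comes from C: its orientation, given by the thin facets, stays the
   same, but the double facet moves to the other side of the thin surface, so
   that the two thin facets are met in the opposite order.

   That S \ D meets D only in C relies on S being a manifold: every edge lies in
   two triangles and vertex links are connected.  These two properties and the
   Euler characteristic are invariant under stellar moves. *)
Require Import Defs.
From mathcomp Require Import all_boot all_order all_algebra.
From mathcomp Require Import reals zify.

Set Implicit Arguments.
Unset Strict Implicit.
Unset Printing Implicit Defensive.

Import Order.TTheory GRing.Theory Num.Theory.
Local Open Scope ring_scope.

(** * Euler characteristic and stellar subdivisions *)

(** Three obstacles shape the proof. A sphere is given only by a chain of stellar subdivisions and
    their inverses, so each property used must be invariant in both directions; link connectedness
    is therefore stated by means of functions on triangles, which can be pulled back to a
    subdivision and pushed down from it. Edge counts alone would not do: they allow [S :\: D] to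
    touch [D] at a single vertex off [C], which is what connected links exclude. The hypothesis on
    [S] speaks of points of space, whereas Euler characteristics are sums over simplices.
    Barycenters translate the former into a statement about common faces. [positive] asks for a
    condition at all edges of a circle, so its failure concerns a priori only some edge, and the
    effect of the flip could not be read off locally. It is therefore shown that the condition holds
    at all edges as soon as it holds at one, by following the three sheets through each vertex of
    the circle. *)

Section EulerCharacteristic.
Variable T : finType.
Implicit Types (K L X Y : {set {set T}}) (s t u : {set T}).

Lemma setD1_notin (y : T) u : y \notin u -> u :\ y = u.
Proof.
by move=> yu; apply/setP=> z; rewrite !inE; case: eqP => //= ->; rewrite (negPf yu).
Qed.

(** Toggling the membership of [y] is a sign-reversing involution on the sets satisfying [P]. *)
Lemma alternating_sum_eq0 (y : T) (P : pred {set T}) :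
    (forall u, P (y |: u) = P u) ->
  \sum_(u | P u) (-1) ^+ #|u| = 0 :> int.
Proof.
move=> Py; rewrite (bigID (fun u => y \in u)) /=.
rewrite (reindex_onto (fun u => y |: u) (fun u => u :\ y)) /=; last first.
  by move=> u /andP[_ yu]; rewrite setD1K.
have eqP' u : [&& P (y |: u), y \in y |: u & (y |: u) :\ y == u]
    = P u && (y \notin u).
  rewrite Py setU11; congr (_ && _).
  apply/eqP/idP => [<-|yu]; first by rewrite !inE eqxx.
  by rewrite setU1K.
rewrite (eq_bigl (fun u => P u && (y \notin u))); last by move=> u; rewrite -eqP' andbA.
rewrite -big_split big1 //= => u /andP[_ yu].
by rewrite cardsU1 yu exprS mulN1r addNr.
Qed.

Lemma sign_pred n : (0 < n)%N -> (-1) ^+ n.-1 = - (-1) ^+ n :> int.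
Proof. by case: n => // n _; rewrite exprS mulN1r opprK. Qed.

Lemma euler_setU X Y : euler (X :|: Y) = euler X + euler Y - euler (X :&: Y).
Proof.
rewrite /euler (big_setID Y) [in RHS](big_setID Y (A := X)) /= setIUl setIid.
rewrite (setUidPr (subsetIr X Y)) setDUl setDv setU0.
by rewrite [RHS]addrC !addrA addNr add0r addrC.
Qed.

End EulerCharacteristic.

(** * Closed triangulated surfaces, combinatorially *)

Section Surfaces.
Variable T : finType.
Implicit Types (K : {set {set T}}) (e t : {set T}).

Definition triangles_over K e : {set {set T}} :=
  [set t in K | (#|t| == 3%N) && (e \subset t)].

Definition dim_le2 K : Prop := forall t, t \in K -> (#|t| <= 3)%N.

(** The count 0 is for pairs that are not an edge of any triangle, [e] being an arbitrary pair of
    vertices. *)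
Definition pseudo_surface K : Prop := forall e, #|e| = 2%N ->
  #|triangles_over K e| = 0%N \/ #|triangles_over K e| = 2%N.

(* Connectedness of the link of v: a function on the triangles at v that does
   not change across edges at v is constant. *)
Definition links_connected K : Prop := forall (v : T) (g : pred {set T}),
  (forall x t1 t2, x != v -> t1 \in triangles_over K [set v; x] ->
     t2 \in triangles_over K [set v; x] -> g t1 = g t2) ->
  forall t1 t2, t1 \in triangles_over K [set v] ->
    t2 \in triangles_over K [set v] -> g t1 = g t2.

(** The dimension bound is carried along because the counts of triangles in a subdivision rely on
    [u :|: s] having at most three vertices. *)
Definition is_surface K : Prop :=
  [/\ dim_le2 K, pseudo_surface K & links_connected K].

Lemma in_triangles_over K e t :
  (t \in triangles_over K e) = [&& t \in K, #|t| == 3%N & e \subset t].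
Proof. by rewrite inE. Qed.

End Surfaces.

(** * Invariance under stellar subdivision *)

Section Stellar.
Variable T : finType.
Implicit Types (K L : {set {set T}}) (s t u e : {set T}).

(** As [w] is new, no old simplex contains it, so membership of [w] decides from which half of
    [stellar] a simplex comes. *)
Lemma in_stellar K s w t : w \notin cover K ->
  (t \in stellar K s w) =
    if w \in t then ~~ (s \subset t :\ w) && ((t :\ w) :|: s \in K)
    else (t \in K) && ~~ (s \subset t).
Proof.
move=> /bigcupP wK; have wNt t' : t' \in K -> w \notin t'.
  by move=> t'K; apply: contra_notN wK => wt'; exists t'.
rewrite !inE; case: ifPn => wt.
  have -> : (t \in K) = false by apply: contraTF wt => /wNt.
  apply/imsetP/andP => [[u]|[su uK]]; last first.
    by exists (t :\ w); rewrite ?setD1K // inE su.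
  rewrite inE => /andP[su usK] ->; have := wNt _ usK.
  by rewrite inE => /norP[wu _]; rewrite setU1K.
suff /negPf -> : t \notin
    [set w |: u | u in [set u : {set T} | ~~ (s \subset u) & u :|: s \in K]].
  by rewrite orbF.
by apply: contra wt => /imsetP[u _ ->]; rewrite setU11.
Qed.

Section Move.
Variables (K : {set {set T}}) (s : {set T}) (w : T).
Hypotheses (s_neq0 : s != set0) (wK : w \notin cover K).
Let L := stellar K s w.

Let wNt t : t \in K -> w \notin t.
Proof. by move=> tK; apply: contra wK => wt; apply/bigcupP; exists t. Qed.

Lemma in_stellarN t : w \notin t -> (t \in L) = (t \in K) && ~~ (s \subset t).
Proof. by rewrite in_stellar // => /negPf ->. Qed.

Lemma in_stellarU u : w \notin u ->
  (w |: u \in L) = ~~ (s \subset u) && (u :|: s \in K).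
Proof. by move=> wu; rewrite in_stellar // setU11 setU1K. Qed.

Lemma stellar_split t : t \in L -> w \in t ->
  exists u, [/\ t = w |: u, w \notin u, ~~ (s \subset u) & u :|: s \in K].
Proof.
move=> tL wt; exists (t :\ w).
rewrite setD1K // !inE eqxx; split=> //.
  by move: tL; rewrite in_stellar // wt => /andP[].
by move: tL; rewrite in_stellar // wt => /andP[].
Qed.

(** The simplices containing neither [s] nor [w] are common to both complexes. The cones [w |: u]
    are grouped by [t = u :|: s], a simplex of [K] containing [s]. Over all [u] with [u :|: s = t]
    the signs cancel, and the only such [u] containing [s] is [t] itself, so the others contribute
    exactly what [t] does. *)
Lemma euler_stellar : euler L = euler K.
Proof.
rewrite /euler (bigID (fun t => w \in t)) /= [in RHS](bigID (fun t => s \subset t)) /=.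
congr (_ + _); last first.
  apply: eq_bigl => t; case: (boolP (w \in t)) => wt; last first.
    by rewrite in_stellarN //= andbT.
  by rewrite andbF; apply/esym; apply: contraTF wt => /andP[/wNt].
rewrite (reindex_onto (fun u => w |: u) (fun u => u :\ w)) /=; last first.
  by move=> u /andP[_ wu]; rewrite setD1K.
rewrite (eq_bigl (fun u => ~~ (s \subset u) && (u :|: s \in K))); last first.
  move=> u; rewrite setU11 andbT; case: (boolP (w \in u)) => wu.
    rewrite (_ : _ == u = false) ?andbF; last first.
      by apply: contraTF wu => /eqP <-; rewrite !inE eqxx.
    by apply/esym; apply: contraTF wu => /andP[_ /wNt]; rewrite inE => /norP[].
  by rewrite setU1K // eqxx andbT in_stellarU.
rewrite (eq_bigr (fun u => (-1) ^+ #|u|)); last first.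
  move=> u /andP[_ /wNt]; rewrite inE => /norP[wu _].
  by rewrite cardsU1 wu.
rewrite (partition_big (fun u => u :|: s)
  (fun t => (t \in K) && (s \subset t))) /=; last first.
  by move=> u /andP[_ ->]; rewrite subsetUr.
apply: eq_bigr => t /andP[tK st].
(* Toggling a vertex [y] of [s] in [u] does not change [u :|: s]. *)
have [y ys] := set0Pn _ s_neq0.
have ysE : y |: s = s by apply/setUidPr; rewrite sub1set.
have Py u : ((y |: u) :|: s == t) = (u :|: s == t).
  by rewrite setUC setUA (setUC s) ysE setUC.
have := @alternating_sum_eq0 _ y (fun u => u :|: s == t) Py.
rewrite (bigD1 t) /=; last by rewrite (setUidPl st).
have t_gt0 : (0 < #|t|)%N.
  by rewrite card_gt0; apply/set0Pn; exists y; apply: subsetP ys.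
move/eqP; rewrite sign_pred // addrC addr_eq0 => /eqP <-.
apply: eq_bigl => u; apply/andP/andP => [[/andP[su usK] /eqP ust]|[/eqP ust ut]].
  by rewrite ust; split => //; apply: contraNneq su => ->.
rewrite ust eqxx tK; split=> //; rewrite andbT.
by apply: contraNN ut => su; rewrite -ust (setUidPl su).
Qed.


(** A cone [w |: u] is no larger than [u :|: s], which strictly contains [u]; conversely a simplex
    [t] containing [s] has the size of the cone over [t :\ y], for any vertex [y] of [s]. *)
Lemma dim_stellar : dim_le2 L <-> dim_le2 K.
Proof.
have [y ys] := set0Pn _ s_neq0; split=> dimK t tK; last first.
  case: (boolP (w \in t)) => wt; last first.
    by move: tK; rewrite in_stellarN // => /andP[/dimK].
  have [u [-> wu su usK]] := stellar_split tK wt.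
  apply: leq_trans (dimK _ usK); rewrite cardsU1 wu; apply: proper_card.
  by apply: properUl.
case: (boolP (s \subset t)) => st; last first.
  by apply: dimK; rewrite in_stellarN ?wNt // tK.
have yt := subsetP st _ ys.
have wt : w \notin t :\ y by rewrite !inE negb_and (wNt tK) orbT.
have <- : #|w |: (t :\ y)| = #|t| by rewrite cardsU1 wt (cardsD1 y t) yt.
apply: dimK; rewrite in_stellarU //; apply/andP; split.
  by apply/subsetPn; exists y => //; rewrite !inE eqxx.
rewrite (_ : _ :|: s = t) //; apply/setP=> z; rewrite !inE.
case: (eqVneq z y) => [->|_] /=; first by rewrite ys yt.
by case: (boolP (z \in s)) => [/(subsetP st)->|]; rewrite ?orbT ?orbF.
Qed.

Lemma setD1U t y : y \in s -> s \subset t -> (t :\ y) :|: s = t.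
Proof.
move=> ys st; apply/setP=> z; rewrite !inE.
case: (eqVneq z y) => [->|_] /=; first by rewrite ys (subsetP st).
by case: (boolP (z \in s)) => [/(subsetP st)->|]; rewrite ?orbT ?orbF.
Qed.

Hypothesis dimK : dim_le2 K.

Lemma card_setUs u : #|u| = 2%N -> ~~ (s \subset u) -> u :|: s \in K ->
  #|u :|: s| = 3%N.
Proof.
move=> u2 su /dimK le3; apply/eqP; rewrite eqn_leq le3 /=.
by have := proper_card (properUl su); rewrite u2.
Qed.

Lemma setU_setD1 t u y : #|t| = 3%N -> #|u| = 2%N -> u \subset t -> y \in t ->
  y \notin u -> t :\ y = u.
Proof.
move=> t3 u2 ut yt yu; apply/esym/eqP; rewrite eqEcard u2.
rewrite subsetD1 ut yu /=; have := cardsD1 y t.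
by rewrite t3 yt add1n => -[<-].
Qed.

(** The cone [w |: e] takes the place of [e :|: s], the only triangle over [e] that can contain [s];
    the other triangles over [e] are untouched. *)
Lemma triangles_over_old e : #|e| = 2%N -> w \notin e -> ~~ (s \subset e) ->
  #|triangles_over L e| = #|triangles_over K e|.
Proof.
move=> e2 we se.
rewrite -(cardsID [set t : {set T} | w \in t] (triangles_over L e)).
rewrite -(cardsID [set t : {set T} | s \subset t] (triangles_over K e)).
congr (_ + _)%N; last first.
  apply: eq_card => t; rewrite [LHS]in_setD in_set [RHS]in_setD [in RHS]in_set.
  rewrite !in_triangles_over; case: (boolP (w \in t)) => wt /=.
    by apply/esym; apply: contraTF wt => /and3P[_ /wNt].
  by rewrite in_stellarN //; case: (t \in K); case: (s \subset t).
transitivity (e :|: s \in K : nat).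
  transitivity #|if e :|: s \in K then [set w |: e] else set0|; last first.
    by case: ifP => _; rewrite ?cards0 ?cards1.
  apply: eq_card => t; rewrite [LHS]in_setI in_triangles_over in_set -!andbA.
  apply/and4P/idP.
    case=> tL /eqP t3 et wt; have [u [tE wu su usK]] := stellar_split tL wt.
    have ue : u = e.
      apply/esym/eqP; rewrite eqEcard; apply/andP; split.
        apply/subsetP => z ze; have := subsetP et z ze; rewrite tE !inE.
        by case: eqP => // zw; rewrite -zw ze in we.
      by move: t3; rewrite e2 tE cardsU1 wu add1n => -[->].
    by rewrite -ue usK tE inE ue.
  case: ifP => // esK; last by rewrite inE.
  rewrite inE => /eqP->; rewrite in_stellarU // se esK cardsU1 we e2 subsetUr.
  by rewrite setU11.
transitivity #|if e :|: s \in K then [set e :|: s] else set0|.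
  by case: ifP => _; rewrite ?cards0 ?cards1.
apply: eq_card => t; rewrite [RHS]in_setI in_triangles_over in_set -!andbA.
apply/idP/and4P.
  case: ifP => // esK; last by rewrite inE.
  rewrite inE => /eqP->; rewrite esK subsetUl subsetUr; split=> //.
  by rewrite (card_setUs e2).
case=> tK /eqP t3 et st.
have estE : e :|: s = t.
  apply/eqP; rewrite eqEcard subUset et st t3 /=.
  by have := proper_card (properUl se); rewrite e2.
by rewrite estE tK inE.
Qed.

Lemma triangles_over_sub e : w \notin e -> s \subset e -> #|e| = 2%N ->
  triangles_over L e = set0.
Proof.
move=> we se e2; apply/setP=> t; rewrite in_set0 in_triangles_over.
apply/negP => /and3P[tL /eqP t3 et].
case: (boolP (w \in t)) => wt; last first.
  by move: tL; rewrite in_stellarN // (subset_trans se et) andbF.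
have [u [tE wu su usK]] := stellar_split tL wt; case/negP: su.
apply: subset_trans se _; apply/subsetP => z ze; have := subsetP et z ze.
by rewrite tE !inE; case: eqP => // zw; rewrite -zw ze in we.
Qed.

Lemma triangles_over_newE v : v != w ->
  triangles_over L [set w; v] =
  [set w |: (t :\ y) | t in triangles_over K (v |: s), y in s :\ v].
Proof.
move=> vw; apply/setP=> t'; rewrite in_triangles_over; apply/and3P/imset2P.
  case=> tL /eqP t3; rewrite subUset !sub1set => /andP[wt vt].
  have [u [tE wu su usK]] := stellar_split tL wt.
  have u2 : #|u| = 2%N by move: t3; rewrite tE cardsU1 wu add1n => -[].
  have vu : v \in u by move: vt; rewrite tE !inE (negPf vw).
  have [y ys yu] := subsetPn su.
  exists (u :|: s) y.
  - rewrite in_triangles_over usK (card_setUs u2) // subUset sub1set subsetUr.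
    by rewrite inE vu.
  - by rewrite !inE ys andbT; apply: contraNneq yu => ->.
  - by rewrite tE (@setU_setD1 _ u) ?subsetUl ?inE ?ys ?orbT // (card_setUs u2).
case=> t y; rewrite in_triangles_over in_setD1 subUset sub1set.
case/and4P=> tK /eqP t3 vt st /andP[yv ys] ->.
have wt : w \notin t :\ y by rewrite !inE negb_and (wNt tK) orbT.
rewrite in_stellarU // setD1U // tK cardsU1 wt subUset !sub1set setU11.
rewrite in_setU1 in_setD1 (eq_sym v y) yv vt orbT andbT; split=> //.
  by apply/subsetPn; exists y => //; rewrite !inE eqxx.
by have := cardsD1 y t; rewrite (subsetP st) // t3 add1n => -[<-].
Qed.

(* A triangle of L over wv arises from a triangle of K containing v and s by
   replacing with w a vertex of s other than v. *)
Lemma triangles_over_new v : v != w ->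
  #|triangles_over L [set w; v]| = (#|triangles_over K (v |: s)| * #|s :\ v|)%N.
Proof.
move=> vw; rewrite triangles_over_newE // curry_imset2X card_in_imset ?cardsX //.
move=> [t y] [t' y']; rewrite !inE /= !subUset.
move=> /andP[/and3P[tK t3 /andP[_ st]] /andP[_ ys]].
move=> /andP[/and3P[tK' t3' /andP[_ st']] /andP[_ ys']] E.
have wD x u : u \in K -> w \notin u :\ x.
  by move=> uK; rewrite !inE negb_and (wNt uK) orbT.
have E' : t :\ y = t' :\ y' by rewrite -(setU1K (wD y t tK)) E setU1K // wD.
have tt' : t = t' by rewrite -(setD1U ys st) E' setD1U.
rewrite tt'; congr (_, _); apply/eqP; apply: contraT => yy'.
have : y \in t' :\ y' by rewrite !inE yy' -tt' (subsetP st).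
by rewrite -E' !inE eqxx.
Qed.

Lemma pseudo_surface_stellar : pseudo_surface L <-> pseudo_surface K.
Proof.
split=> H e e2.
  have we : w \notin e \/ w \in e by case: (w \in e); [right|left].
  case: we => [we|we]; last first.
    left; apply/eqP; rewrite cards_eq0 -subset0; apply/subsetP => t.
    rewrite in_triangles_over => /and3P[/wNt wt _ /subsetP/(_ _ we)].
    by rewrite (negPf wt).
  case: (boolP (s \subset e)) => se; last by rewrite -triangles_over_old //; apply: H.
  (* As [s] is either [e] or one of its vertices, [e] is [v |: s] for some [v] with a single vertex
     of [s] besides it. Then [triangles_over_new] gives [e] as many triangles as the new edge
     [wv]. *)
  have [v [sv es]] : exists v, #|s :\ v| = 1%N /\ v |: s = e.
    have [/eqP se2|sne] := boolP (s == e).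
      have [y ys] := set0Pn _ s_neq0; exists y.
      have := cardsD1 y s; rewrite ys [in X in X = _]se2 e2 add1n => -[<-]; split=> //.
      by rewrite -se2; apply/setUidPr; rewrite sub1set.
    have [v ve vs] : exists2 v, v \in e & v \notin s.
      by apply/subsetPn; apply: contra sne => es; rewrite eqEsubset se.
    exists v; have s1 : #|s| = 1%N.
      have s_lt_e : s \proper e by rewrite properEneq sne.
      apply/eqP; rewrite eqn_leq card_gt0 s_neq0 andbT.
      by have := proper_card s_lt_e; rewrite e2.
    rewrite setD1_notin //; split=> //; apply/eqP.
    by rewrite eqEcard subUset sub1set ve se cardsU1 vs s1 e2.
  have vw : v != w by apply: contraNneq we => <-; rewrite -es setU11.
  have /H : #|[set w; v]| = 2%N by rewrite cards2 eq_sym vw.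
  by rewrite triangles_over_new // es sv muln1.
case: (boolP (w \in e)) => we; last first.
  case: (boolP (s \subset e)) => se; last by rewrite triangles_over_old //; apply: H.
  by rewrite triangles_over_sub // cards0; left.
have [v eE vw] : exists2 v, e = [set w; v] & v != w.
  have : #|e :\ w| == 1%N by have := cardsD1 w e; rewrite we e2 add1n => -[<-].
  case/cards1P=> v ev; exists v; first by rewrite -(setD1K we) ev.
  by have := set11 v; rewrite -ev !inE => /andP[].
rewrite eE triangles_over_new //.
have vs : #|v |: s| = #|s :\ v|.+1.
  rewrite -add1n; have := cardsU1 v (s :\ v); rewrite !inE eqxx /= => <-.
  by congr #|pred_of_set _|; apply/setP=> z; rewrite !inE; case: eqP.
(* Let [m] be the number of vertices of [s] other than [v]. For [m = 0] the product vanishes; for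
   [m = 1] the set [v |: s] is a pair, to which [H] applies; for [m = 2] it can only be a triangle
   itself, counted twice; beyond that it is too large. *)
case sv: #|s :\ v| vs => [|[|[|n]]] vs; rewrite ?muln0 ?muln1; [by left|exact: H| |].
  have : (#|triangles_over K (v |: s)| <= 1)%N.
    rewrite -(cards1 (v |: s)); apply: subset_leq_card; apply/subsetP => t.
    rewrite in_triangles_over inE => /and3P[_ /eqP t3 vst].
    by rewrite eq_sym eqEcard vst t3 vs.
  by case: #|_| => [|[|]] //; [left|right].
left; rewrite (_ : triangles_over _ _ = set0) ?cards0 //.
apply/setP=> t; rewrite in_triangles_over in_set0; apply/negP => /and3P[_ /eqP t3].
by move=> /subset_leq_card; rewrite t3 vs.
Qed.

Lemma mem_cone t y : t \in triangles_over K s -> y \in s ->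
  w |: (t :\ y) \in triangles_over L [set w].
Proof.
rewrite in_triangles_over => /and3P[tK /eqP t3 st] ys.
have wt : w \notin t :\ y by rewrite !inE negb_and (wNt tK) orbT.
rewrite in_triangles_over sub1set setU11 in_stellarU // setD1U // tK cardsU1 wt.
have := cardsD1 y t; rewrite (subsetP st) // t3 add1n => -[<-]; rewrite !andbT.
by apply/subsetPn; exists y => //; rewrite !inE eqxx.
Qed.

Lemma triangles_overS K' e e' t : t \in triangles_over K' e -> e' \subset t ->
  t \in triangles_over K' e'.
Proof. by rewrite !in_triangles_over => /and3P[-> ->]. Qed.

(** The carrier of [t]: the simplex of [K] in which the simplex [t] of the subdivision lies
    geometrically. *)
Let proj t := if w \in t then (t :\ w) :|: s else t.

Lemma proj_over t e : t \in triangles_over L e -> e \subset proj t ->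
  proj t \in triangles_over K e.
Proof.
rewrite in_triangles_over => /and3P[tL /eqP t3 et].
rewrite /proj in_triangles_over; case: ifPn => wt -> /=.
  have [u [tE wu su usK]] := stellar_split tL wt.
  rewrite tE setU1K // usK (card_setUs _ su) //.
  by move: t3; rewrite tE cardsU1 wu add1n => -[].
by move: tL; rewrite in_stellarN // t3 => /andP[->].
Qed.

Lemma sub_proj t z : z \in t -> z != w -> z \in proj t.
Proof. by rewrite /proj; case: ifP; rewrite // !inE => _ -> ->. Qed.

Lemma in_proj t z : w \in t -> z \in s -> z \in proj t.
Proof. by rewrite /proj => -> zs; rewrite inE zs orbT. Qed.

Lemma proj_cone t y : t \in K -> y \in s -> s \subset t -> proj (w |: (t :\ y)) = t.
Proof.
move=> tK ys st; rewrite /proj setU11 setU1K ?setD1U //.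
by rewrite !inE negb_and (wNt tK) orbT.
Qed.

(** A function on the triangles of [K] at [v] is pulled back along [proj], every such triangle being
    the carrier of a triangle of the subdivision. *)
Lemma links_connected_of_stellar : links_connected L -> links_connected K.
Proof.
move=> HL v g Hg t1 t2 t1v t2v.
have vt t : t \in triangles_over K [set v] -> v \in t.
  by rewrite in_triangles_over sub1set => /and3P[].
have vw : v != w.
  apply: contraTneq (vt _ t1v) => ->; apply: wNt.
  by move: t1v; rewrite in_triangles_over => /and3P[].
(* Subdividing at the vertex [v] itself replaces it by [w], whose link is then the one to use. *)
pose v' := if s == [set v] then w else v.
(* [y0] is the vertex of [s] that a cone drops; unless [v'] is [w], it must differ from [v] for the
   cone to contain [v']. *)
have [y0 y0s y0v] : exists2 y, y \in s & (s == [set v]) || (y != v).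
  have [|sv] := boolP (s == [set v]).
    by move/eqP->; exists v; rewrite ?set11.
  have [y ys] := set0Pn _ s_neq0.
  have [yv|] := eqVneq y v; last by exists y.
  have : ~~ (s \subset [set v]).
    by apply: contra sv => sv; rewrite eqEsubset sv sub1set -yv.
  by case/subsetPn=> z zs; rewrite inE => zv; exists z.
have lift t : t \in triangles_over K [set v] ->
    exists2 t', t' \in triangles_over L [set v'] & proj t' = t.
  move=> tv; have := tv; rewrite in_triangles_over => /and3P[tK t3 _].
  case: (boolP (s \subset t)) => st; last first.
    have sv : (s == [set v]) = false.
      by apply: contraNF st => /eqP->; rewrite sub1set vt.
    exists t; last by rewrite /proj (negPf (wNt tK)).
    by rewrite /v' sv in_triangles_over in_stellarN ?wNt // tK st t3 sub1set vt.
  exists (w |: (t :\ y0)); last exact: proj_cone.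
  have ts : t \in triangles_over K s by rewrite in_triangles_over tK t3.
  apply: triangles_overS (mem_cone ts y0s) _.
  rewrite /v'; move: y0v; case: ifP => /= _; first by rewrite sub1set setU11.
  by move=> y0v; rewrite sub1set !inE (eq_sym v y0) y0v (vt _ tv) orbT.
have [t1' t1v' <-] := lift _ t1v; have [t2' t2v' <-] := lift _ t2v.
apply: (HL v' (fun t => g (proj t))) t1v' t2v'.
move=> {lift t1 t2 t1v t2v t1' t2'} x t1 t2 xv t1x t2x.
(* The carriers of the triangles over an edge at [v'] share an edge at [v]: its other end [z] is
   [x], or [y0] if [x] is the new vertex. *)
suff [z zv zt] : exists2 z, z != v &
    forall t, t \in triangles_over L [set v'; x] -> [set v; z] \subset proj t.
  have pr t : t \in triangles_over L [set v'; x] ->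
      proj t \in triangles_over K [set v; z].
    move=> tx; apply: triangles_overS (zt _ tx).
    apply: (@proj_over t set0); last exact: sub0set.
    by apply: (triangles_overS tx); apply: sub0set.
  by apply: Hg zv (pr _ t1x) (pr _ t2x).
have mem2 t a b : t \in triangles_over L [set a; b] -> a \in t /\ b \in t.
  by rewrite in_triangles_over subUset !sub1set => /and3P[_ _ /andP[]].
have inL e t : t \in triangles_over L e -> t \in L.
  by rewrite in_triangles_over => /and3P[].
move: xv t1x {t2 t2x}; rewrite /v'; have [/eqP sv|sv] := ifPn => xv t1x.
  have [wt1 xt1] := mem2 _ _ _ t1x.
  exists x.
    apply: contraTneq t1x => xv'; apply/negP => /inL t1L.
    have [u [t1E _ /negP[]]] := stellar_split t1L wt1.
    by move: xt1; rewrite sv sub1set t1E !inE xv' (negPf vw).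
  move=> t /mem2[wt xt]; rewrite subUset !sub1set (sub_proj xt xv) andbT.
  by apply: in_proj; rewrite // sv set11.
have y0v' : y0 != v by move: y0v; rewrite (negPf sv).
have [xw|xw] := eqVneq x w.
  exists y0 => // t /mem2[vt']; rewrite xw => wt.
  by rewrite subUset !sub1set (sub_proj vt' vw) in_proj.
by exists x => // t /mem2[vt' xt]; rewrite subUset !sub1set !sub_proj.
Qed.

(** At an old vertex [v], the function [g] descends to a function [h] on the triangles of [K],
    because the pieces at [v] of subdivided triangles all share the edge [vw]. At the new vertex the
    triangles are cones [w |: (t :\ y)] with [t] containing [s], compared directly. *)
Lemma links_connected_stellar : links_connected K -> links_connected L.
Proof.
move=> HK v g Hg.
have mem1 K' t a : t \in triangles_over K' [set a] -> a \in t.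
  by rewrite in_triangles_over sub1set => /and3P[].
have mem2 K' t a b : t \in triangles_over K' [set a; b] -> a \in t /\ b \in t.
  by rewrite in_triangles_over subUset !sub1set => /and3P[_ _ /andP[]].
have inL e t : t \in triangles_over L e -> t \in L.
  by rewrite in_triangles_over => /and3P[].
have split_over t : t \in triangles_over L [set w] -> exists2 u,
    t = w |: u & ~~ (s \subset u) /\ (u :|: s \in triangles_over K s) /\
    forall y, y \in s -> y \notin u -> u = (u :|: s) :\ y.
  move=> tw; have [u [tE wu su usK]] := stellar_split (inL _ _ tw) (mem1 _ _ _ tw).
  have u2 : #|u| = 2%N.
    by move: tw; rewrite in_triangles_over tE cardsU1 wu => /and3P[_ /eqP[]].
  have us3 := card_setUs u2 su usK.
  exists u => //; split=> //; split; first by rewrite in_triangles_over usK subsetUr us3.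
  by move=> y ys yu; rewrite (@setU_setD1 _ u) ?subsetUl // inE ys orbT.
have cone_edge t y e : t \in triangles_over K s -> y \in s -> e \subset w |: (t :\ y) ->
    w |: (t :\ y) \in triangles_over L e.
  by move=> ts ys; apply: triangles_overS (mem_cone ts ys).
have [vw|vw] := eqVneq v w.
  rewrite vw {v vw} in Hg *.
  (* If [s] is a single vertex [z], the link of [w] is the old link of [z]. *)
  have [s1|s1] := leqP #|s| 1.
    have /cards1P[z sE] : #|s| == 1%N by rewrite eqn_leq s1 card_gt0.
    have zs : z \in s by rewrite sE set11.
    move=> t1' t2' /split_over[u1 -> [su1 [u1s u1E]]] /split_over[u2 -> [su2 [u2s u2E]]].
    move: su1 su2; rewrite sE !sub1set => zu1 zu2.
    rewrite (u1E z) // (u2E z) //; move: u1s u2s; rewrite sE.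
    apply: (HK z (fun t => g (w |: (t :\ z)))) => x t1 t2 xz.
    have sub_x t : t \in triangles_over K [set z; x] ->
        w |: (t :\ z) \in triangles_over L [set w; x].
      move=> tx; apply: cone_edge => //.
        by apply: (triangles_overS tx); rewrite sE sub1set (mem2 _ _ _ _ tx).1.
      by rewrite subUset !sub1set !inE eqxx xz (mem2 _ _ _ _ tx).2 orbT.
    move=> t1x t2x; apply: (Hg x); rewrite ?sub_x //.
    apply/negP => /eqP xw; have := mem2 _ _ _ _ t1x => -[_]; rewrite xw.
    by apply/negP/wNt; move: t1x; rewrite in_triangles_over => /and3P[].
  have over_s t : t \in triangles_over K s -> [/\ t \in K, #|t| = 3%N & s \subset t].
    by rewrite in_triangles_over => /and3P[tK /eqP].
  (* With the same [y] dropped, the two cones share the edge from [w] to another vertex of [s]. *)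
  have indep_t t1 t2 y : t1 \in triangles_over K s -> t2 \in triangles_over K s ->
      y \in s -> g (w |: (t1 :\ y)) = g (w |: (t2 :\ y)).
    move=> t1s t2s ys; have [x] : exists x, x \in s :\ y.
      by apply/set0Pn; rewrite -card_gt0; move: s1; rewrite (cardsD1 y s) ys.
    rewrite !inE => /andP[xy xs]; have [t1K _ st1] := over_s _ t1s.
    have [_ _ st2] := over_s _ t2s.
    have xw : x != w by apply: contraTneq (subsetP st1 _ xs) => ->; apply: wNt.
    apply: (Hg x); rewrite ?cone_edge // subUset !sub1set !inE eqxx xy.
      by rewrite (subsetP st1 _ xs) orbT.
    by rewrite (subsetP st2 _ xs) orbT.
  (* Within one triangle [t], the two cones share the edge from [w] to a vertex of [t] other than
     [y1] and [y2]. *)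
  have indep_y t y1 y2 : t \in triangles_over K s -> y1 \in s -> y2 \in s ->
      g (w |: (t :\ y1)) = g (w |: (t :\ y2)).
    move=> ts y1s y2s; have [tK t3 st] := over_s _ ts.
    have [x] : exists x, x \in t :\ y1 :\ y2.
      apply/set0Pn; rewrite -card_gt0.
      have := cardsD1 y1 t; have := cardsD1 y2 (t :\ y1); rewrite t3.
      by case: (_ \in _); case: (_ \in _); case: #|_ :\ y2| => // ->.
    rewrite !inE => /and3P[xy2 xy1 xt].
    have xw : x != w by apply: contraTneq xt => ->; apply: wNt.
    by apply: (Hg x); rewrite ?cone_edge // subUset !sub1set !inE eqxx ?xy1 ?xy2 xt orbT.
  move=> t1' t2' /split_over[u1 -> [/subsetPn[y1 y1s y1u] [u1s u1E]]].
  move=> /split_over[u2 -> [/subsetPn[y2 y2s y2u] [u2s u2E]]].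
  by rewrite (u1E y1) // (u2E y2) // (indep_t _ (u2 :|: s)) // (indep_y _ y1 y2).
have [sv|sv] := eqVneq s [set v].
  move=> t1 t2 t1v; have vt := mem1 _ _ _ t1v.
  have t1L := inL _ _ t1v; case: (boolP (w \in t1)) => wt; last first.
    by move: t1L; rewrite in_stellarN // sv sub1set vt andbF.
  have [u [tE wu]] := stellar_split t1L wt.
  by move: vt; rewrite tE sv sub1set !inE (negPf vw) /= => ->.
have [y0 y0s y0v] : exists2 y, y \in s & y != v.
  have : ~~ (s \subset [set v]) by rewrite subset1 negb_or sv.
  by case/subsetPn=> z zs; rewrite inE => zv; exists z.
(* The choice of [y0] is immaterial: by [indep], every vertex of [s] other than [v] gives the same
   value. *)
pose h t := if s \subset t then g (w |: (t :\ y0)) else g t.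
have over_v t y : t \in triangles_over K [set v] -> s \subset t -> y \in s -> y != v ->
    w |: (t :\ y) \in triangles_over L [set v; w].
  move=> tv st ys yv; apply: cone_edge => //; last first.
    by rewrite subUset !sub1set !inE eqxx (mem1 _ _ _ tv) (eq_sym v y) yv orbT.
  by move: tv; rewrite !in_triangles_over st => /and3P[-> ->].
have indep t1 t2 y1 y2 : t1 \in triangles_over K [set v] ->
    t2 \in triangles_over K [set v] -> s \subset t1 -> s \subset t2 ->
    y1 \in s -> y2 \in s -> y1 != v -> y2 != v ->
    g (w |: (t1 :\ y1)) = g (w |: (t2 :\ y2)).
  by move=> *; apply: (Hg w); rewrite ?over_v // eq_sym.
have old t e : t \in triangles_over K e -> ~~ (s \subset t) -> t \in triangles_over L e.
  rewrite !in_triangles_over => /and3P[tK -> ->] st.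
  by rewrite in_stellarN ?wNt // tK st.
have mixed x t1 t2 : x != v -> t1 \in triangles_over K [set v; x] ->
    t2 \in triangles_over K [set v; x] ->
    s \subset t1 -> ~~ (s \subset t2) -> h t1 = h t2.
  move=> xv t1x t2x st1 st2; rewrite /h st1 (negPf st2).
  have t1v : t1 \in triangles_over K [set v].
    by apply: (triangles_overS t1x); rewrite sub1set (mem2 _ _ _ _ t1x).1.
  have [y ys] : exists2 y, y \in s & y \notin [set v; x].
    apply/subsetPn; apply: contra st2 => /subset_trans; apply.
    by move: t2x; rewrite in_triangles_over => /and3P[].
  rewrite !inE negb_or => /andP[yv yx].
  rewrite (indep t1 t1 y0 y) //; apply: (Hg x) => //; last exact: old.
  have [vt1 xt1] := mem2 _ _ _ _ t1x.
  apply: cone_edge => //; last first.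
    by rewrite subUset !sub1set !inE vt1 xt1 (eq_sym v y) yv (eq_sym x y) yx !orbT.
  by move: t1v; rewrite !in_triangles_over st1 => /and3P[-> ->].
have gh t : t \in triangles_over L [set v] ->
    proj t \in triangles_over K [set v] /\ g t = h (proj t).
  move=> tv; have vt := mem1 _ _ _ tv; have ptv : proj t \in triangles_over K [set v].
    by apply: (proj_over tv); rewrite sub1set sub_proj.
  split=> //; have tL := inL _ _ tv; move: ptv; rewrite /proj; case: ifPn => wt ptv.
    have [|u tE [/subsetPn[y ys yu] [us uE]]] := split_over t.
      apply: (@triangles_overS _ t); last by rewrite sub1set.
      by move: tv; rewrite !in_triangles_over subxx => /and3P[-> ->].
    have wu : w \notin u.
      move: us; rewrite in_triangles_over => /and3P[/wNt].
      by rewrite inE negb_or => /andP[].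
    move: ptv; rewrite tE setU1K // => ptv; rewrite /h subsetUr {1}(uE y) //.
    apply: indep; rewrite ?subsetUr //.
    by apply: contraNneq yu => ->; move: vt; rewrite tE !inE (negPf vw).
  by move: tL; rewrite in_stellarN // /h => /andP[_ /negPf->].
move=> t1' t2' /gh[t1v ->] /gh[t2v ->]; apply: (HK v h) t1v t2v.
move=> x t1 t2 xv t1x t2x.
have sub_v t : t \in triangles_over K [set v; x] -> t \in triangles_over K [set v].
  by move=> tx; apply: (triangles_overS tx); rewrite sub1set (mem2 _ _ _ _ tx).1.
have [st1|st1] := boolP (s \subset t1); have [st2|st2] := boolP (s \subset t2).
- by rewrite /h st1 st2; apply: indep; rewrite ?sub_v.
- exact: (mixed x).
- by apply/esym/(mixed x).
- by rewrite /h (negPf st1) (negPf st2); apply: (Hg x); rewrite ?old.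
Qed.

End Move.

Lemma is_surface_stellar K s w : s != set0 -> w \notin cover K ->
  is_surface (stellar K s w) <-> is_surface K.
Proof.
move=> s0 wK; have dimE := dim_stellar s0 wK; split=> -[dimKL pK lK].
  have dimK := dimE.1 dimKL; split=> //.
    by apply: (pseudo_surface_stellar s0 wK dimK).1.
  exact: links_connected_of_stellar lK.
split; first exact: dimE.2; first exact: (pseudo_surface_stellar s0 wK dimKL).2.
exact: links_connected_stellar.
Qed.

(** [stellar_move] admits the empty simplex as centre, and such a move destroys the complex. The
    chains of [stellar_equiv_inv] avoid it, since their complexes stay nonempty and free of the
    empty simplex. *)
Lemma stellar0 K w : stellar K set0 w = set0.
Proof.
apply/setP=> t; rewrite !inE sub0set andbF /=; apply/negbTE/imsetP => -[u].
by rewrite inE sub0set.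
Qed.

Lemma stellar_equiv_inv (P : {set {set T}} -> Prop) :
    (forall K s w, s != set0 -> w \notin cover K ->
       P (stellar K s w) <-> P K) ->
  forall K L, stellar_equiv K L -> K != set0 -> set0 \notin K -> P K <-> P L.
Proof.
move=> Pinv K L /connectP[p]; elim: p K => [|K1 p IHp] K /=; first by move=> _ ->.
case/andP=> step pathp defL K_neq0 K_set0.
suff [K1_neq0 K1_set0 <-] : [/\ K1 != set0, set0 \notin K1 & P K1 <-> P K].
  exact: IHp.
have wN K' w t : w \notin cover K' -> t \in K' -> w \notin t.
  by move=> wK' tK'; apply: contra wK' => wt; apply/bigcupP; exists t.
case/orP: step => /existsP[s /andP[sK /existsP[w /andP[wK /eqP E]]]].
  have s0 : s != set0 by apply: contraNneq K_set0 => <-.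
  split; last by rewrite E; apply: Pinv.
    have [y ys] := set0Pn _ s0; apply/set0Pn; exists (w |: (s :\ y)).
    have ws := wN _ _ _ wK sK.
    rewrite E in_stellarU ?inE ?(negPf ws) ?andbF // setD1U // sK andbT.
    by apply/subsetPn; exists y => //; rewrite !inE eqxx.
  by rewrite E in_stellarN ?inE // (negPf K_set0).
have s0 : s != set0 by apply: contraNneq K_neq0 => s0; rewrite E s0 stellar0.
split; last by rewrite E; apply: iff_sym; apply: Pinv.
  by apply/set0Pn; exists s.
by move: K_set0; rewrite E in_stellarN ?inE // subset0 s0 andbT.
Qed.

End Stellar.

(** * Relabelling of vertices and combinatorial homeomorphism *)

Section Transfer.
Variables (T W : finType) (f : T -> W).
Hypothesis f_inj : injective f.
Implicit Types (K : {set {set T}}) (s t e : {set T}).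
Let img K := [set f @: s | s : {set T} in K].

Lemma mem_img K t : (f @: t \in img K) = (t \in K).
Proof. by apply: mem_imset; apply: imset_inj. Qed.

Lemma euler_img K : euler (img K) = euler K.
Proof.
rewrite /euler big_imset /=; last by move=> s t _ _; apply: imset_inj.
by apply: eq_bigr => s _; rewrite card_imset.
Qed.

Lemma imset_sub s t : (f @: s \subset f @: t) = (s \subset t).
Proof.
apply/idP/idP => [/subsetP st|]; last exact: imsetS.
by apply/subsetP => x xs; have := st _ (imset_f f xs); rewrite mem_imset.
Qed.

Lemma triangles_over_img K e t :
  (f @: t \in triangles_over (img K) (f @: e)) = (t \in triangles_over K e).
Proof. by rewrite !in_triangles_over mem_img card_imset // imset_sub. Qed.

Lemma triangles_over_imgP K (e' t' : {set W}) : t' \in triangles_over (img K) e' ->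
  exists t e, [/\ t' = f @: t, e' = f @: e & t \in triangles_over K e].
Proof.
move=> t'e; have := t'e; rewrite in_triangles_over => /and3P[/imsetP[t tK tE] _ et].
rewrite tE in et t'e *.
have eE : e' = f @: (f @^-1: e').
  apply/setP=> x; apply/idP/imsetP => [xe|[y]]; last by rewrite inE => ? ->.
  have [y yt E] := imsetP (subsetP et _ xe).
  by exists y; rewrite // inE -E.
by exists t, (f @^-1: e'); split=> //; rewrite -triangles_over_img -eE.
Qed.

Lemma preimsetK e : f @^-1: (f @: e) = e.
Proof. by apply/setP=> x; rewrite inE mem_imset. Qed.

Lemma imset_pair x y : f @: [set x; y] = [set f x; f y].
Proof. by rewrite imsetU1 imset_set1. Qed.

Lemma is_surface_img K : is_surface (img K) <-> is_surface K.
Proof.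
have card_img e : #|triangles_over (img K) (f @: e)| = #|triangles_over K e|.
  rewrite -(card_imset _ (imset_inj f_inj)); apply: eq_card => t'.
  apply/idP/imsetP => [/[dup] /triangles_over_imgP[t [_ [-> _ _]]]|[t te ->]].
    by rewrite triangles_over_img; exists t.
  by rewrite triangles_over_img.
split=> -[dimK pK lK]; split.
- by move=> t tK; have := dimK (f @: t); rewrite mem_img card_imset //; apply.
- by move=> e e2; rewrite -card_img; apply: pK; rewrite card_imset.
- move=> v g Hg t1 t2; rewrite -!triangles_over_img imset_set1 => t1v t2v.
  have := lK (f v) (fun t' : {set W} => g (f @^-1: t')) _ _ _ t1v t2v.
  rewrite !preimsetK; apply=> x' t1' t2' xv /triangles_over_imgP[t1x [e [-> eE t1e]]].
  have : x' \in f @: e by rewrite -eE !inE eqxx orbT.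
  case/imsetP=> x _ E; rewrite E in xv.
  move=> /triangles_over_imgP[t2x [e2 [-> /esym]]].
  rewrite eE => /(imset_inj f_inj) -> t2e; rewrite !preimsetK.
  have eE' : e = [set v; x] by apply: (imset_inj f_inj); rewrite imset_pair -E.
  rewrite eE' in t1e t2e; apply: Hg t1e t2e.
  by apply: contraNneq xv => ->.
- by move=> t' /imsetP[t tK ->]; rewrite card_imset // dimK.
- move=> e' e2; have [->|[t']] := set_0Vmem (triangles_over (img K) e').
    by left; rewrite cards0.
  case/triangles_over_imgP=> _ [e [_ eE _]].
  by rewrite eE card_img; apply: pK; rewrite -(card_imset _ f_inj) -eE.
move=> v' g Hg t1' t2' /triangles_over_imgP[t1 [e1 [-> eE1 t1e]]].
move=> /triangles_over_imgP[t2 [e2 [-> eE2 t2e]]].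
have e12 : e1 = e2 by apply: (imset_inj f_inj); rewrite -eE1.
have /imsetP[v _ vE] : v' \in f @: e1 by rewrite -eE1 set11.
have e1v : e1 = [set v] by apply: (imset_inj f_inj); rewrite imset_set1 -vE.
rewrite -e12 e1v in t2e; rewrite e1v in t1e.
apply: (lK v (fun t => g (f @: t))) t1e t2e => x s1 s2 xv s1x s2x.
by apply: (Hg (f x)); rewrite ?vE ?(inj_eq f_inj) // -imset_pair triangles_over_img.
Qed.

End Transfer.

(** [P] is a family over all vertex types because the chain of moves takes place in a third type
    [W]. *)
Lemma comb_homeo_inv (T U : finType) (K : {set {set T}}) (L : {set {set U}})
    (P : forall W : finType, {set {set W}} -> Prop) :
    (forall (W : finType) (M : {set {set W}}) (s : {set W}) (w : W),
       s != set0 -> w \notin cover M ->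
       P W (stellar M s w) <-> P W M) ->
    (forall (V W : finType) (f : V -> W) (M : {set {set V}}), injective f ->
       P W [set f @: s | s : {set V} in M] <-> P V M) ->
  comb_homeo K L -> K != set0 -> set0 \notin K -> P U L -> P T K.
Proof.
move=> Pst Pimg [W [f [g [f_inj g_inj eqv]]]] K0 KN0 /(Pimg _ _ g _ g_inj) PL.
apply/(Pimg _ _ f _ f_inj)/(stellar_equiv_inv (Pst W) eqv) => //.
  by have [s sK] := set0Pn _ K0; apply/set0Pn; exists (f @: s); apply: imset_f.
by apply: contra KN0 => /imsetP[s sK /esym/eqP]; rewrite imset_eq0 => /eqP <-.
Qed.

(** * The model disk and the model sphere *)

Lemma sum_simplices (T : finType) : (0 < #|T|)%N ->
  \sum_(s : {set T} | s != set0) (-1) ^+ #|s|.-1 = 1 :> int.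
Proof.
case/card_gt0P => y _.
have := @alternating_sum_eq0 _ y xpredT (fun=> erefl).
(* In the vanishing sum over all subsets the empty set contributes 1, so the nonempty ones add up to
   -1; the shift of the exponent changes this sign. *)
rewrite (bigD1 set0) //= cards0 expr0 => /eqP; rewrite addr_eq0 => /eqP H.
rewrite [RHS]H -sumrN; apply: eq_bigr => s s0.
by rewrite sign_pred // card_gt0.
Qed.

Lemma euler_disk (T : finType) (K : {set {set T}}) :
  K != set0 -> set0 \notin K -> is_disk K -> euler K = 1.
Proof.
move=> K0 KN0 Kd.
apply: (comb_homeo_inv (P := fun W M => euler M = 1) _ _ Kd) => //.
- by move=> W M s w s0 wM; rewrite euler_stellar.
- by move=> V W f M f_inj; rewrite euler_img.
rewrite /euler (eq_bigl (fun s : {set 'I_3} => s != set0)) => [|s]; last by rewrite inE.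
by rewrite sum_simplices ?card_ord.
Qed.

(** The boundary of the tetrahedron is the full simplex, of Euler characteristic 1, without its top
    cell, which counts -1. *)
Lemma euler_sphere (T : finType) (K : {set {set T}}) :
  K != set0 -> set0 \notin K -> is_sphere K -> euler K = 2.
Proof.
move=> K0 KN0 Kd.
apply: (comb_homeo_inv (P := fun W M => euler M = 2) _ _ Kd) => //.
- by move=> W M s w s0 wM; rewrite euler_stellar.
- by move=> V W f M f_inj; rewrite euler_img.
rewrite /euler (eq_bigl (fun s : {set 'I_4} => (s != set0) && (s != setT))); last first.
  by move=> s; rewrite inE.
have := @sum_simplices 'I_4; rewrite card_ord => /(_ isT).
rewrite (bigD1 [set: 'I_4]) /=; last by rewrite -card_gt0 cardsT card_ord.
by rewrite cardsT card_ord (_ : (-1) ^+ 4.-1 = -1) // => /(canRL (addKr _)) ->.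
Qed.

(** The triangles are the complements of single vertices, so those over a pair correspond to the two
    vertices outside it. Two triangles through [v] have 3 + 3 vertices among 4, hence share a second
    one. *)
Lemma is_surface_boundary (U : finType) : #|U| = 4%N ->
  is_surface [set s : {set U} | s != set0 & s != setT].
Proof.
move=> U4; pose M := [set s : {set U} | s != set0 & s != setT].
have c3 (t : {set U}) : #|t| = 3%N -> exists y, t = ~: [set y].
  move=> t3; have /eqP/cards1P[y E] : #|~: t| = 1%N by rewrite cardsCs setCK t3 U4.
  by exists y; rewrite -E setCK.
have inM (t : {set U}) : #|t| = 3%N -> t \in M.
  move=> t3; rewrite inE -card_gt0 t3 /=; apply: contra_eqN t3 => /eqP->.
  by rewrite cardsT U4.
split.
- move=> t; rewrite inE => /andP[_ tT].
  have /proper_card : t \proper setT by rewrite properEneq tT subsetT.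
  by rewrite cardsT U4.
- move=> e e2; right.
  have -> : triangles_over M e = [set ~: [set y] | y in ~: e].
    apply/setP=> t; rewrite in_triangles_over; apply/and3P/imsetP.
      case=> _ /eqP/c3[y ->] ey; exists y => //.
      by move: ey; rewrite inE subsetC sub1set inE.
    case=> y; rewrite inE => ye ->.
    have y3 : #|~: [set y]| = 3%N by rewrite cardsCs setCK cards1 U4.
    by rewrite inM // y3 subsetC sub1set inE.
  rewrite card_imset; last by move=> x y /setC_inj/set1_inj.
  by rewrite cardsCs setCK e2 U4.
move=> v g Hg t1 t2; rewrite !in_triangles_over !sub1set.
move=> /and3P[t1M /eqP t13 vt1] /and3P[t2M /eqP t23 vt2].
have [x] : exists x, x \in (t1 :&: t2) :\ v.
  apply/set0Pn; rewrite -card_gt0.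
  have := cardsD1 v (t1 :&: t2); rewrite inE vt1 vt2 /= add1n.
  have := cardsUI t1 t2; rewrite t13 t23.
  have := subset_leq_card (subsetT (t1 :|: t2)); rewrite cardsT U4.
  by move=> le4 E1 E2; lia.
rewrite !inE => /and3P[xv xt1 xt2].
by apply: (Hg x) => //; rewrite in_triangles_over subUset !sub1set
  ?t1M ?t2M ?t13 ?t23 ?vt1 ?vt2 ?xt1 ?xt2.
Qed.

Lemma is_surface_sphere (T : finType) (K : {set {set T}}) :
  K != set0 -> set0 \notin K -> is_sphere K -> is_surface K.
Proof.
move=> K0 KN0 Kd.
apply: (comb_homeo_inv (P := fun W M => is_surface M) _ _ Kd) => //.
- by move=> W M s w s0 wM; apply: is_surface_stellar.
- by move=> V W f M f_inj; apply: is_surface_img.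
by apply: is_surface_boundary; rewrite card_ord.
Qed.

(** * Foams *)

Section Barycenter.
Variables (R : realType) (T : finType) (pos : T -> 'rV[R]_3).
Implicit Types (K : {set {set T}}) (s t : {set T}).

Definition barycenter s : 'rV[R]_3 := \sum_(v in s) #|s|%:R^-1 *: pos v.

Lemma hull_barycenter s : s != set0 -> hull pos s (barycenter s).
Proof.
rewrite -card_gt0 => s0; exists (fun=> #|s|%:R^-1); split=> //.
  by move=> v _; rewrite invr_ge0 ler0n.
by rewrite /= sumr_const -[LHS]mulr_natl mulfV // pnatr_eq0 -lt0n.
Qed.

(** By embeddedness the barycenter lies in the hull of [s :&: t]. Affine coordinates in [s] are
    unique and those of the barycenter are all nonzero, so no vertex of [s] is missing from [t]. *)
Lemma barycenter_sub K s t : embedded pos K -> s \in K -> t \in K -> s != set0 ->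
  hull pos t (barycenter s) -> s \subset t.
Proof.
move=> [indep meet] sK tK s0 /(meet _ _ sK tK _ (hull_barycenter s0)).
case=> a [_ a1 aE]; apply/subsetP => v vs; apply: contraT => vt.
(* The difference of two coordinate systems of the same point, the second extended by 0 off [t]. *)
pose b v := #|s|%:R^-1 - (if v \in t then a v else 0).
have b0 : \sum_(v in s) b v = 0.
  rewrite sumrB -big_mkcondr /= sumr_const -[X in X - _]mulr_natl mulfV; last first.
    by rewrite pnatr_eq0 -lt0n card_gt0.
  by rewrite -a1; apply/eqP; rewrite subr_eq0; apply/eqP/eq_bigl => u; rewrite inE.
have bpos : \sum_(v in s) b v *: pos v = 0.
  under eq_bigr do rewrite scalerBl.
  rewrite sumrB -/(barycenter s) aE.
  have -> : \sum_(u in s :&: t) a u *: pos u = \sum_(u in s | u \in t) a u *: pos u.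
    by apply: eq_bigl => u; rewrite inE.
  rewrite big_mkcondr /= -sumrB big1 // => u us; case: ifP => _; rewrite ?subrr //.
  by rewrite scale0r subr0.
move/eqP: (indep s sK b b0 bpos v vs); rewrite /b (negPf vt) subr0 invr_eq0.
by rewrite pnatr_eq0 cards_eq0 (negPf s0).
Qed.

End Barycenter.

Lemma connect_ind (T : finType) (e : rel T) (P : T -> Prop) x :
    P x -> (forall y z, e y z -> P y -> P z) ->
  forall y, connect e x y -> P y.
Proof.
move=> Px Pe y /connectP[p]; elim: p x Px => [|z p IHp] x Px /=; first by move=> _ ->.
by case/andP=> /Pe/(_ Px)/IHp H /H.
Qed.

(** * Edges, stars and facets *)

Section FoamCombinatorics.
Variables (T : finType) (F : prefoam T).
Implicit Types (s t e : {set T}) (f : {set {set T}}).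

Lemma in_faces (X : {set {set T}}) s :
  (s \in faces X) = (s != set0) && [exists t in X, s \subset t].
Proof. by rewrite inE. Qed.

Lemma facesP (X : {set {set T}}) s :
  reflect (s != set0 /\ exists2 t, t \in X & s \subset t) (s \in faces X).
Proof.
rewrite in_faces; apply: (iffP andP) => -[s0 H]; split=> //.
  by case/existsP: H => t /andP[tX st]; exists t.
by case: H => t tX st; apply/existsP; exists t; rewrite tX.
Qed.

Lemma in_star e t : (t \in star F e) = (t \in triangles F) && (e \subset t).
Proof. by rewrite inE. Qed.

Lemma in_edges e : (e \in edges F) = (e \in faces (triangles F)) && (#|e| == 2%N).
Proof. by rewrite inE. Qed.

Lemma edge_star e t : #|e| = 2%N -> t \in star F e -> e \in edges F.
Proof.
move=> e2; rewrite in_star => /andP[tF et]; rewrite in_edges e2 andbT.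
by apply/facesP; split; [rewrite -card_gt0 e2 | exists t].
Qed.

Lemma in_regular e : (e \in regular_edges F) = (e \in edges F) && (#|star F e| == 2%N).
Proof. by rewrite inE. Qed.

Lemma in_singular e : (e \in singular_edges F) = (e \in edges F) && (#|star F e| == 3%N).
Proof. by rewrite inE. Qed.

Lemma regular_not_singular e : e \in regular_edges F -> e \notin singular_edges F.
Proof. by rewrite in_regular in_singular => /andP[-> /eqP->]. Qed.

Lemma edge_card e : e \in edges F -> #|e| = 2%N.
Proof. by rewrite in_edges => /andP[_ /eqP]. Qed.

Lemma singular_card e : e \in singular_edges F -> #|e| = 2%N.
Proof. by rewrite in_singular => /andP[/edge_card]. Qed.

Lemma regular_card e : e \in regular_edges F -> #|e| = 2%N.
Proof. by rewrite in_regular => /andP[/edge_card]. Qed.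

Lemma facet_adjP s t :
  reflect (exists2 e, e \in regular_edges F & s \in star F e /\ t \in star F e)
          (facet_adj F s t).
Proof.
apply: (iffP existsP) => [[e /and3P[]]|[e er [se te]]]; first by exists e.
by exists e; rewrite er se te.
Qed.

Lemma facet_adj_sym : connect_sym (facet_adj F).
Proof.
by apply: sym_connect_sym => s t; apply/facet_adjP/facet_adjP => -[e ? []]; exists e.
Qed.

Lemma facet_equiv :
  {in triangles F & &, equivalence_rel (connect (facet_adj F))}.
Proof.
move=> s t u _ _ _; split=> // st; exact: (same_connect facet_adj_sym st).
Qed.

Lemma facets_partition : partition (facets F) (triangles F).
Proof. exact: equivalence_partitionP facet_equiv. Qed.

Lemma facet_ofE t : t \in triangles F ->
  facet_of F t = [set s in triangles F | connect (facet_adj F) t s].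
Proof.
move=> tF; apply/setP=> s; rewrite inE.
have [sF|sF] := boolP (s \in triangles F).
  exact: (pblock_equivalence_partition facet_equiv).
apply: contraNF sF => st; rewrite -(cover_partition facets_partition).
apply/bigcupP; exists (facet_of F t) => //; apply: pblock_mem.
by rewrite (cover_partition facets_partition).
Qed.

Lemma facet_of_id t : t \in triangles F -> t \in facet_of F t.
Proof. by move=> tF; rewrite facet_ofE // inE tF connect0. Qed.

Lemma facet_of_facets t : t \in triangles F -> facet_of F t \in facets F.
Proof. by move=> tF; apply: pblock_mem; rewrite (cover_partition facets_partition). Qed.

Lemma facetsP f : f \in facets F ->
  exists2 t, t \in triangles F & f = facet_of F t.
Proof.
move=> fF; have /and3P[/eqP cov triv f0] := facets_partition.
have /set0Pn[t tf] : f != set0 by apply: contraNneq f0 => <-.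
exists t; last by rewrite /facet_of (def_pblock triv fF tf).
by rewrite -cov; apply/bigcupP; exists f.
Qed.
End FoamCombinatorics.

Lemma set3C12 (T : finType) (a b c : T) : [set a; b; c] = [set b; a; c].
Proof. by rewrite (setUC [set a]). Qed.

Lemma set3C23 (T : finType) (a b c : T) : [set a; b; c] = [set a; c; b].
Proof. by rewrite setUAC. Qed.

Lemma rot_order_rot (R : realType) (T : finType) (pos : T -> 'rV[R]_3) p q a b c :
  rot_order pos p q a b c = rot_order pos p q b c a.
Proof. by rewrite /rot_order -addnA addnC. Qed.

Section Foam.
Variables (R : realType) (T : finType) (pos : T -> 'rV[R]_3) (F : prefoam T).
Hypothesis foam : is_foam pos F.
Implicit Types (s t e : {set T}).

Lemma tri3 t : t \in triangles F -> #|t| = 3%N.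
Proof. exact: foam_triangles foam t. Qed.

Lemma tri_neq a b c : [set a; b; c] \in triangles F -> [/\ a != b, a != c & b != c].
Proof.
move=> /tri3 abc3; split; apply: contra_eqN abc3 => /eqP E.
- by rewrite E setUid cards2; case: (b != c).
- by rewrite E setUAC setUid cards2; case: (c != b).
- by rewrite E -setUA setUid cards2; case: (a != c).
Qed.

Lemma tri_inj a b c d : [set a; b; c] \in triangles F ->
  [set a; b; c] = [set a; b; d] -> c = d.
Proof.
move=> /tri_neq[_ ac bc] E; have : c \in [set a; b; d] by rewrite -E !inE eqxx !orbT.
by rewrite !inE (eq_sym c a) (negPf ac) (eq_sym c b) (negPf bc) => /eqP.
Qed.

Lemma tri_split a b t : a != b -> t \in star F [set a; b] ->
  exists2 c, t = [set a; b; c] & [set a; b; c] \in triangles F.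
Proof.
rewrite in_star => ab /andP[tF abt].
have /cards1P[c E] : #|t :\: [set a; b]| == 1%N.
  by rewrite cardsD (setIidPr abt) tri3 // cards2 ab.
by have tE : t = [set a; b; c]; [rewrite -E setDE setUIr setUCr setIT (setUidPr abt)|
  exists c; rewrite -?tE].
Qed.

Lemma star_set3 a b c : [set a; b; c] \in triangles F ->
  [set a; b; c] \in star F [set a; b].
Proof. by move=> tF; rewrite in_star tF subsetUl. Qed.

Lemma facet_adj_thin s t : facet_adj F s t -> (s \in thin F) = (t \in thin F).
Proof. by case/facet_adjP=> e er [se te]; apply: (foam_regular_edges foam er). Qed.

Lemma connect_thin s t : connect (facet_adj F) s t -> (s \in thin F) = (t \in thin F).
Proof.
move: t; apply: connect_ind => // t u tu ->; exact: facet_adj_thin.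
Qed.

Lemma connect_facet_of s t : s \in triangles F -> connect (facet_adj F) s t ->
  facet_of F s = facet_of F t.
Proof.
move=> sF st; have tF : t \in triangles F.
  move: t st; apply: connect_ind => // t u /facet_adjP[e _ [_]].
  by rewrite in_star => /andP[].
rewrite !facet_ofE //; apply/setP=> u; rewrite !inE.
by rewrite (same_connect (facet_adj_sym F) st).
Qed.

Lemma same_sheet_connect v s t : same_sheet F v s t -> connect (facet_adj F) s t.
Proof.
move: s t; apply: connect_sub => s t /existsP[e /and4P[er _ se te]].
by apply/connect1/facet_adjP; exists e.
Qed.

Lemma same_sheet_sym v s t : same_sheet F v s t = same_sheet F v t s.
Proof.
apply: sym_connect_sym => {}s {}t; apply: eq_existsb => e.
by congr [&& _, _ & _]; apply: andbC.
Qed.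

(** * Sheets around a singular vertex *)

Section Darts.
Variable v : T.

(* The dart (a, b) is the triangle vab, traversed from va to vb. *)
Definition dart_step (d d' : T * T) : Prop :=
  [/\ [set v; d.2] \in regular_edges F, d'.1 = d.2, d'.2 != d.1,
     [set v; d.1; d.2] \in triangles F & [set v; d'.1; d'.2] \in triangles F].

(** [same_sheet] forgets the direction in which a sheet is traversed. The walk keeps it, so that
    orientations at the two ends of a sheet can be compared and sheets starting at different
    triangles can be told apart. *)
Inductive dart_reach (d0 : T * T) : T * T -> Prop :=
| dart_reach0 : dart_reach d0 d0
| dart_reachS d d' : dart_reach d0 d -> dart_step d d' -> dart_reach d0 d'.

Lemma dart_reach_case d0 d : dart_reach d0 d ->
  d = d0 \/ exists2 d', dart_reach d0 d' & dart_step d' d.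
Proof. by case=> [|d1 d2]; [left|right; exists d1]. Qed.

Lemma regular_star x a b c : [set v; x] \in regular_edges F ->
  [set v; x; a] \in triangles F -> [set v; x; b] \in triangles F ->
  [set v; x; c] \in triangles F -> a != c -> b != c -> a = b.
Proof.
rewrite in_regular => /andP[_ /eqP star2] ta tb tc ac bc.
apply/eqP; apply: contra_eqT star2 => ab.
have sub : [set [set v; x; a]; [set v; x; b]; [set v; x; c]] \subset star F [set v; x].
  by apply/subsetP => t; rewrite !inE -orbA => /or3P[]/eqP->; rewrite ?ta ?tb ?tc subsetUl.
rewrite neq_ltn; apply/orP; right; apply: leq_trans (subset_leq_card sub).
rewrite -setUA cardsU1 cards2 !inE negb_or.
have inj y z : [set v; x; y] \in triangles F -> y != z -> [set v; x; y] != [set v; x; z].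
  by move=> ty yz; apply: contraNneq yz => /(tri_inj ty)->.
by rewrite !inj.
Qed.

Lemma dart_step_inj d1 d2 d : dart_step d1 d -> dart_step d2 d -> d1 = d2.
Proof.
case: d1 d2 d => [a1 x1] [a2 x2] [x b] [/= x1r -> bx1 t1 t] [/= x2r E bx2 t2 _].
congr (_, _) => //; rewrite E in x2r t t2 *; rewrite -E in t t1 x1r t2 x2r *.
by apply: (@regular_star x1 _ _ b) => //; rewrite 1?set3C23 // eq_sym.
Qed.

(** A step can be undone in only one way, a regular edge having just two triangles, and no step
    enters a dart that starts at the singular edge [va]. Going back from [d] thus leads to a single
    start. *)
Lemma dart_reach_inj a x y d : [set v; a] \in singular_edges F ->
  dart_reach (a, x) d -> dart_reach (a, y) d -> x = y.
Proof.
move=> va rx; have no_pred z d' : ~ dart_step d' (a, z).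
  case=> /= dr ad _ _ _; rewrite -ad in dr.
  by have := regular_not_singular dr; rewrite va.
elim: rx => [|d1 d2 r1 IH step] /dart_reach_case[].
- by case.
- by case=> d' _ /no_pred.
- by move=> E; move: step; rewrite E => /no_pred.
by case=> d3 r3 step3; apply: IH; rewrite (dart_step_inj step step3).
Qed.

(** The walk from [va] sweeps out the whole sheet, because leaving a visited triangle backwards only
    leads to a triangle visited before. *)
Lemma sheet_dart a x s : [set v; a] \in singular_edges F ->
  [set v; a; x] \in triangles F -> same_sheet F v [set v; a; x] s ->
  exists2 d, dart_reach (a, x) d &
    s = [set v; d.1; d.2] /\ [set v; d.1; d.2] \in triangles F.
Proof.
move=> va tax; move: s; apply: connect_ind => [|s t].
  by exists (a, x); first exact: dart_reach0.
case/existsP=> e /and4P[er ve se te] [[u u'] /= r [sE tu]].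
have [<-|st] : s = t \/ s != t by case: eqP; [left|right].
  by exists (u, u').
have /cards1P[z ez] : #|e :\ v| == 1%N.
  by have := cardsD1 v e; rewrite ve (regular_card er) add1n => -[<-].
have zv : z != v by have := set11 z; rewrite -ez !inE => /andP[].
have {}ez : e = [set v; z] by rewrite -ez setD1K.
rewrite ez in er se te.
have [y tE ty] : exists2 y, t = [set v; z; y] & [set v; z; y] \in triangles F.
  by apply: tri_split te; rewrite eq_sym.
have : z \in s by move: se; rewrite in_star subUset !sub1set => /and3P[].
rewrite sE !inE (negPf zv) /= => /orP[]/eqP zE; rewrite zE in er tE ty.
  (* The edge back is the first one of the dart. The dart is not the start, whose first edge [va] is
     singular, so [t] is the preceding triangle of the walk. *)
  have [[E1 _]|[[p q] r1 step]] := dart_reach_case r.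
    by have := regular_not_singular er; rewrite E1 va.
  have [/= ur uq up tp _] := step.
  exists (p, q) => //=; split=> //; rewrite tE -uq (set3C23 v p u).
  congr (_ :|: [set _]).
  apply: (@regular_star u _ _ u') => //; rewrite 1?(set3C23 v u p) 1?uq //.
    by apply: contraNneq st => yu; rewrite sE tE yu.
  by rewrite eq_sym.
exists (u', y) => //=; apply: dart_reachS r _; split=> //=.
apply: contraNneq st => yu; rewrite tE yu sE; apply/eqP; exact: set3C23.
Qed.

End Darts.

Lemma ori_swap23 a b c : [set a; b; c] \in triangles F -> ori F a c b = ~~ ori F a b c.
Proof.
move=> abc; have acb : [set a; c; b] \in triangles F by rewrite set3C23.
have cab : [set c; a; b] \in triangles F by rewrite set3C12.
have [E _] := foam_ori foam abc; have [E1 E2] := foam_ori foam acb.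
by have [E3 _] := foam_ori foam cab; rewrite E2 E3.
Qed.

Lemma ori_swap12 a b c : [set a; b; c] \in triangles F -> ori F b a c = ~~ ori F a b c.
Proof. by move=> abc; have [_ ->] := foam_ori foam abc; rewrite negbK. Qed.

(** Two triangles sharing a regular edge orient it oppositely, and the walk leaves the one and
    enters the other along that edge; the two changes of sign cancel. *)
Lemma dart_ori v d0 d : dart_reach v d0 d -> ori F v d.1 d.2 = ori F v d0.1 d0.2.
Proof.
elim=> // {}d [u w] _ <- [/= er -> wd td tw].
rewrite -[RHS]negbK -(ori_swap23 td) (foam_ori_regular foam er (c := d.1) (d := w)) ?negbK //.
  by rewrite eq_sym.
by rewrite set3C23.
Qed.

Lemma singular_star p q x y z : [set p; q] \in singular_edges F ->
  [set p; q; x] \in triangles F -> [set p; q; y] \in triangles F ->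
  [set p; q; z] \in triangles F -> x != y -> x != z -> y != z ->
  star F [set p; q] = [set [set p; q; x]; [set p; q; y]; [set p; q; z]].
Proof.
rewrite in_singular => /andP[_ /eqP star3] tx ty tz xy xz yz.
apply/esym/eqP; rewrite eqEcard; apply/andP; split.
  by apply/subsetP => t; rewrite !inE -orbA => /or3P[]/eqP->; rewrite ?tx ?ty ?tz subsetUl.
have inj b c : [set p; q; b] \in triangles F -> b != c -> [set p; q; b] != [set p; q; c].
  by move=> tb bc; apply: contraNneq bc => /(tri_inj tb)->.
by rewrite star3 -setUA cardsU1 cards2 !inE negb_or !inj.
Qed.

Lemma sheet_to_edge v a b s : a != b -> [set v; a] \in singular_edges F ->
  [set v; b] \in singular_edges F -> s \in star F [set v] ->
  exists2 t, t \in star F [set v; b] & same_sheet F v s t.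
Proof.
move=> ab va vb sv; have vF : v \in cover (triangles F).
  by move: sv; rewrite in_star sub1set => /andP[sF vs]; apply/bigcupP; exists s.
have sing x : [set v; x] \in singular_edges F -> [set v; x] \in singular_at F v.
  by move=> vx; rewrite inE vx !inE eqxx.
case: (foam_vertices foam vF) => [[v0 _]|[a0 [b0 [_ vE sheets]]]].
  by have := sing _ vb; rewrite v0 inE.
have [H1 H2] := sheets _ sv.
by have := sing _ vb; rewrite vE !inE => /orP[]/eqP->.
Qed.

Lemma sheet_across v a b x : a != b -> [set v; a] \in singular_edges F ->
  [set v; b] \in singular_edges F -> [set v; a; x] \in triangles F ->
  exists x', [/\ [set v; b; x'] \in triangles F,
    same_sheet F v [set v; a; x] [set v; b; x'] & dart_reach v (a, x) (x', b)].
Proof.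
move=> ab va vb tx; have [|t tb st] := @sheet_to_edge v a b [set v; a; x] ab va vb.
  by rewrite in_star tx sub1set !inE eqxx.
have vb' : v != b by have := singular_card vb; rewrite cards2; case: (v != b).
have [d rd [tE td]] := sheet_dart va tx st.
have : b \in t by move: tb; rewrite in_star subUset !sub1set => /and3P[].
rewrite tE !inE (eq_sym b v) (negPf vb') /= => /orP[]/eqP bE.
  (* A dart whose first edge is [vb] would be the start or be entered through [vb], which is
     singular; so [vb] is where the walk ends. *)
  have [dE|[d' _ [/= d'r dd' _ _ _]]] := dart_reach_case rd.
    by case/negP: ab; rewrite bE dE.
  by have := regular_not_singular d'r; rewrite -dd' -bE vb.
exists d.1; rewrite bE set3C23 -tE; split=> //; last by case: (d) rd.
by rewrite tE.
Qed.

(** By [dart_reach_inj] distinct triangles at [va] lead to distinct triangles at [vb], so both stars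
    are listed in full, as [foam_cyclic] requires. It is applied in both directions because [pos_at]
    refers to a directed edge. *)
Lemma rot_across v a b x y z : a != b -> [set v; a] \in singular_edges F ->
    [set v; b] \in singular_edges F -> [set v; a; x] \in triangles F ->
    [set v; a; y] \in triangles F -> [set v; a; z] \in triangles F ->
    x != y -> x != z -> y != z ->
  exists x' y' z', [/\ [/\ x' != y', x' != z' & y' != z'],
    [/\ [set v; b; x'] \in triangles F, [set v; b; y'] \in triangles F
       & [set v; b; z'] \in triangles F] /\ dart_reach v (a, z) (z', b),
    [/\ same_sheet F v [set v; a; x] [set v; b; x'],
       same_sheet F v [set v; a; y] [set v; b; y'] &
       same_sheet F v [set v; a; z] [set v; b; z']],
    rot_order pos a v x y z = rot_order pos v b x' y' z' &
    rot_order pos v a x y z = rot_order pos b v x' y' z'].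
Proof.
move=> ab va vb tx ty tz xy xz yz.
have [x' [tx' sx rx]] := sheet_across ab va vb tx.
have [y' [ty' sy ry]] := sheet_across ab va vb ty.
have [z' [tz' sz rz]] := sheet_across ab va vb tz.
have xy' : x' != y'.
  by apply: contraNneq xy => E; rewrite E in rx; rewrite (dart_reach_inj va rx ry).
have xz' : x' != z'.
  by apply: contraNneq xz => E; rewrite E in rx; rewrite (dart_reach_inj va rx rz).
have yz' : y' != z'.
  by apply: contraNneq yz => E; rewrite E in ry; rewrite (dart_reach_inj va ry rz).
have sa := singular_star va tx ty tz xy xz yz.
have sb := singular_star vb tx' ty' tz' xy' xz' yz'.
exists x', y', z'; split=> //.
  by apply: (foam_cyclic foam ab); rewrite ?(setUC [set a] [set v]).
apply/esym; apply: (foam_cyclic foam (v := v) (a := b) (b := a));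
  by rewrite 1?eq_sym ?(setUC [set b] [set v]) // same_sheet_sym.
Qed.

(** * The sign of a singular circle *)

Section Positivity.
Variable c : {ffun {set {set T}} -> bool}.

(** The condition of [positive] at a single directed edge, so that it can be moved from edge to
    edge. *)
Definition pos_at (p q : T) : Prop := forall d a b,
  [set p; q; d] \in triangles F :\: thin F -> [set p; q; a] \in thin F ->
  [set p; q; b] \in thin F -> a != b -> ori F p q a -> first_ccw pos p q d a b ->
  c (facet_of F [set p; q; a]).

Definition pos_edge e : Prop := forall p q, e = [set p; q] -> pos_at p q.

Lemma positiveP (C : {set {set T}}) :
  reflect (forall e, e \in C -> pos_edge e) (positive pos F c C).
Proof.
apply: (iffP forallP) => [H e eC p q eE d a b pqd pqa pqb ab o f|H p].
  have /forallP/(_ q)/forallP/(_ d)/forallP/(_ a)/forallP/(_ b)/implyP := H p.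
  by apply; rewrite pqd pqa pqb ab o f -eE eC.
apply/forallP=> q; apply/forallP=> d; apply/forallP=> a; apply/forallP=> b.
apply/implyP=> /and5P[pqC pqd pqa pqb /and3P[ab o f]].
exact: (H _ pqC _ _ erefl d a b).
Qed.

Lemma thinF t : t \in thin F -> t \in triangles F.
Proof. exact: (subsetP (foam_thin foam)). Qed.

(** The direction from [a] to [v] continues as that from [v] to [b]. Following the three sheets
    through [v] preserves thinness, facets, orientation and cyclic order, hence every ingredient of
    [pos_at]. *)
Lemma pos_at_across v a b : a != b -> [set v; a] \in singular_edges F ->
  [set v; b] \in singular_edges F ->
  (pos_at v b -> pos_at a v) /\ (pos_at b v -> pos_at v a).
Proof.
move=> ab va vb.
have across d x y : [set v; a; d] \in triangles F :\: thin F ->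
    [set v; a; x] \in thin F -> [set v; a; y] \in thin F -> x != y ->
  exists d' x' y', [/\ [set v; b; d'] \in triangles F :\: thin F,
    [/\ [set v; b; x'] \in thin F, [set v; b; y'] \in thin F & x' != y'],
    facet_of F [set v; a; x] = facet_of F [set v; b; x'],
    ori F v b x' = ori F a v x /\ ori F b v x' = ori F v a x &
    rot_order pos a v d y x = rot_order pos v b d' y' x' /\
    rot_order pos v a d y x = rot_order pos b v d' y' x'].
  rewrite inE => /andP[dthin dF] xthin ythin xy.
  have neq u w : [set v; a; u] \notin thin F -> [set v; a; w] \in thin F -> u != w.
    by move=> uN; apply: contraTneq => <-.
  have [d' [y' [x' [[_ dx' yx'] [[td ty tx] rx] [sd sy sx] E1 E2]]]] :=
    rot_across ab va vb dF (thinF ythin) (thinF xthin) (neq _ _ dthin ythin)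
      (neq _ _ dthin xthin) (contra_neq (@esym _ _ _) xy).
  have th u u' : same_sheet F v [set v; a; u] [set v; b; u'] ->
      ([set v; b; u'] \in thin F) = ([set v; a; u] \in thin F).
    by move/same_sheet_connect/connect_thin.
  exists d', x', y'; split=> //.
  - by rewrite inE (th _ _ sd) dthin.
  - by split; rewrite ?(th _ _ sx) ?(th _ _ sy) // eq_sym.
  - exact: connect_facet_of (thinF xthin) (same_sheet_connect sx).
  have /= o := dart_ori rx; have txb : [set v; x'; b] \in triangles F by rewrite set3C23.
  by rewrite (ori_swap12 tx) (ori_swap23 txb) (ori_swap12 (thinF xthin)) o negbK.
split=> H d x y; rewrite ?(set3C12 a v) => pd px py xy o f.
  have [d' [x' [y' [pd' [px' py' xy'] -> [o' _] [r _]]]]] := across _ _ _ pd px py xy.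
  by apply: H pd' px' py' xy' _ _; rewrite ?o' // /first_ccw -r.
have [d' [x' [y' [pd' [px' py' xy'] -> [_ o'] [_ r]]]]] := across _ _ _ pd px py xy.
rewrite (set3C12 v b x'); apply: (H d' x' y'); rewrite 1?(set3C12 b v) ?o' //.
by rewrite /first_ccw -r.
Qed.

Lemma pos_edge_adj e e' : circle_adj F e e' -> pos_edge e -> pos_edge e'.
Proof.
case/and3P=> es e's; rewrite -setI_eq0 => /set0Pn[v]; rewrite inE => /andP[ve ve'].
have pair f : f \in singular_edges F -> v \in f -> exists2 a, a != v & f = [set v; a].
  move=> fs vf; have /cards1P[a aE] : #|f :\ v| == 1%N.
    by have := cardsD1 v f; rewrite vf (singular_card fs) add1n => -[<-].
  exists a; first by have := set11 a; rewrite -aE !inE => /andP[].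
  by rewrite -aE setD1K.
have [a av eE] := pair _ es ve; have [b bv e'E] := pair _ e's ve'.
have [ab|ab] := eqVneq a b; first by rewrite eE e'E ab.
rewrite eE e'E in es e's *.
have ba : b != a by rewrite eq_sym.
have [H1 H2] := pos_at_across ba e's es => H p q pqE.
have : p \in [set v; b] by rewrite pqE !inE eqxx.
have : q \in [set v; b] by rewrite pqE !inE eqxx orbT.
have pq : p != q.
  by have := singular_card e's; rewrite pqE cards2; case: (p != q).
rewrite !inE => /orP[]/eqP qE /orP[]/eqP pE.
- by rewrite pE qE eqxx in pq.
- by rewrite pE qE; apply/H1/H.
- by rewrite pE qE; apply/H2/H; rewrite setUC.
- by rewrite pE qE eqxx in pq.
Qed.

Lemma circle_adj_sym : connect_sym (circle_adj F).
Proof.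
apply: sym_connect_sym => e e'; rewrite /circle_adj disjoint_sym.
by rewrite andbCA.
Qed.

Lemma circles_partition : partition (circles F) (singular_edges F).
Proof.
apply: equivalence_partitionP => e e' e'' _ _ _; split=> // ee'.
exact: (same_connect circle_adj_sym ee').
Qed.

Lemma circleP C e e' : C \in circles F -> e \in C ->
  (e' \in C) = connect (circle_adj F) e e' && (e' \in singular_edges F).
Proof.
move=> CF eC; have /and3P[/eqP cov triv _] := circles_partition.
have es : e \in singular_edges F by rewrite -cov; apply/bigcupP; exists C.
have [e's|e's] := boolP (e' \in singular_edges F); last first.
  rewrite andbF; apply: contraNF e's => e'C; rewrite -cov; apply/bigcupP; by exists C.
rewrite andbT -(def_pblock triv CF eC) (pblock_equivalence_partition _ es e's) //.
by move=> f f' f'' _ _ _; split=> // ff'; exact: (same_connect circle_adj_sym ff').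
Qed.

(** The sign of a circle can be read off at any one of its edges, as [pos_edge] passes to adjacent
    edges and these connect the circle. *)
Lemma positive_edge C e : C \in circles F -> e \in C ->
  positive pos F c C <-> pos_edge e.
Proof.
move=> CF eC; split=> [/positiveP/(_ e eC) //|H]; apply/positiveP => e'.
rewrite (circleP _ CF eC) => /andP[+ _]; move: e'.
by apply: connect_ind => // f f'; apply: pos_edge_adj.
Qed.

(* [pos_edge] quantifies over both directions of the edge, but only the one
   given by the orientation contributes. *)
Lemma pos_edge_iff p q d a b : [set p; q] \in singular_edges F ->
    [set p; q; d] \in triangles F :\: thin F -> [set p; q; a] \in thin F ->
    [set p; q; b] \in thin F -> a != b -> ori F p q a ->
  pos_edge [set p; q] <->
    (first_ccw pos p q d a b -> c (facet_of F [set p; q; a])) /\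
    (first_ccw pos p q d b a -> c (facet_of F [set p; q; b])).
Proof.
move=> pqs pd pa pb ab o.
have ob : ori F p q b.
  by move: o; rewrite (foam_ori_singular foam pqs pa pd) (foam_ori_singular foam pqs pb pd).
have ba : b != a by rewrite eq_sym.
split=> [H|[Ha Hb] p' q' E].
  by split=> f; [apply: (H p q erefl d a b)|apply: (H p q erefl d b a)].
have [dF aF bF] : [/\ [set p; q; d] \in triangles F, [set p; q; a] \in triangles F
    & [set p; q; b] \in triangles F].
  by move: pd; rewrite inE => /andP[_ dF]; split=> //; apply: thinF.
have dthin : [set p; q; d] \notin thin F by move: pd; rewrite inE => /andP[].
have neq u : [set p; q; u] \in thin F -> u != d.
  by apply: contraTneq => ->.
have starE := singular_star pqs aF bF dF ab (neq a pa) (neq b pb).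
have over u : [set p; q; u] \in triangles F -> [|| u == a, u == b | u == d].
  move=> uF; have := star_set3 uF; rewrite starE !inE -orbA.
  by case/or3P=> /eqP/(tri_inj uF)->; rewrite eqxx ?orbT.
have thin_over u : [set p; q; u] \in thin F -> (u == a) || (u == b).
  move=> ut; have := over u (thinF ut); rewrite orbA => /orP[//|/eqP uE].
  by move: dthin; rewrite -uE ut.
have pq : p != q by have [] := tri_neq dF.
have p'pq : p' \in [set p; q] by rewrite E !inE eqxx.
have q'pq : q' \in [set p; q] by rewrite E !inE eqxx orbT.
have p'q' : p' != q' by have := singular_card pqs; rewrite E cards2; case: (p' != q').
move: p'pq q'pq p'q'; rewrite !inE => /orP[]/eqP-> /orP[]/eqP->; rewrite ?eqxx //.
  move=> _ d' a' b'; rewrite inE => /andP[d't d'F] a't b't a'b' _.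
  have -> : d' = d.
    have := over d' d'F; rewrite orbA => /orP[/orP[]/eqP d'E|/eqP//].
      by move: d't; rewrite d'E pa.
    by move: d't; rewrite d'E pb.
  move: a'b'; case/orP: (thin_over _ a't) => /eqP->;
    case/orP: (thin_over _ b't) => /eqP->; rewrite ?eqxx //.
move=> _ d' a' b' _; rewrite (set3C12 q p) => a't _ _.
rewrite (ori_swap12 (thinF a't)).
by case/orP: (thin_over _ a't) => /eqP->; rewrite ?o ?ob.
Qed.

End Positivity.
End Foam.

(** * Facets, colored surfaces and singular circles *)

Section FoamFacets.
Variables (R : realType) (T : finType) (pos : T -> 'rV[R]_3) (F : prefoam T).
Hypothesis foam : is_foam pos F.
Implicit Types (s t e : {set T}) (f C : {set {set T}}).

Lemma facet_of_sub t s : t \in triangles F -> s \in facet_of F t ->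
  s \in triangles F /\ (s \in thin F) = (t \in thin F).
Proof.
move=> tF; rewrite facet_ofE // inE => /andP[-> ts]; split=> //.
by rewrite -(connect_thin foam ts).
Qed.

Lemma facet_of_double t : t \in triangles F ->
  (facet_of F t \in double_facets F) = (t \notin thin F).
Proof.
move=> tF; rewrite inE facet_of_facets //=; apply/idP/idP => [/disjointFr-> //|].
  exact: facet_of_id.
move=> tN; rewrite disjoint_subset; apply/subsetP => s /(facet_of_sub tF)[_ sE].
by rewrite inE sE.
Qed.

Lemma thin_facetsP f : reflect (exists2 t, t \in thin F & f = facet_of F t)
  (f \in thin_facets F).
Proof.
rewrite inE; apply: (iffP andP) => [[/facetsP[t tF ->] fthin]|[t tthin ->]].
  by exists t => //; apply: (subsetP fthin); apply: facet_of_id.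
have tF := thinF foam tthin; rewrite facet_of_facets //; split=> //.
by apply/subsetP => s /(facet_of_sub tF)[_ ->].
Qed.

Lemma facet_of_eq f t : f \in facets F -> t \in f -> facet_of F t = f.
Proof.
move=> fF tf; have /and3P[_ triv _] := facets_partition F.
exact: def_pblock.
Qed.

Lemma facet_triangles f t : f \in facets F -> t \in f -> t \in triangles F.
Proof.
move=> fF tf; rewrite -(cover_partition (facets_partition F)).
by apply/bigcupP; exists f.
Qed.

Lemma connect_facet f s t : f \in facets F -> s \in f ->
  connect (facet_adj F) s t -> t \in f.
Proof.
move=> fF sf st; have sF := facet_triangles fF sf.
rewrite -(facet_of_eq fF sf) facet_ofE // inE st andbT.
move: t st; apply: connect_ind => // t u /facet_adjP[e _ [_]].
by rewrite in_star => /andP[].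
Qed.

Lemma colored_coverE (c : {ffun {set {set T}} -> bool}) i :
  cover [set f in facets F | (f \in double_facets F) || (c f == i)] =
  [set t in triangles F | (t \notin thin F) || (c (facet_of F t) == i)].
Proof.
apply/setP=> t; rewrite inE; apply/bigcupP/andP => [[f]|[tF tc]].
  rewrite inE => /andP[fF fc] tf; have tF := facet_triangles fF tf; split=> //.
  by move: fc; rewrite -(facet_of_eq fF tf) facet_of_double.
exists (facet_of F t); last exact: facet_of_id.
by rewrite inE facet_of_facets // facet_of_double.
Qed.

(** Were [v] regular, all triangles at [v] would lie in one facet. So it is singular, and each of
    its sheets, in particular that of [t], reaches a singular edge. *)
Lemma vertex_between f t t' v : f \in facets F -> t \in f -> t' \in triangles F ->
    t' \notin f -> v \in t -> v \in t' ->
  exists e, [/\ e \in singular_edges F, v \in e & exists2 s, s \in f & e \subset s].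
Proof.
move=> fF tf t'F t'f vt vt'; have tF := facet_triangles fF tf.
have star_v u : u \in triangles F -> v \in u -> u \in star F [set v].
  by move=> uF vu; rewrite in_star uF sub1set.
have vF : v \in cover (triangles F) by apply/bigcupP; exists t.
case: (foam_vertices foam vF) => [[_ sheet]|[a [b [_ vE sheets]]]].
  case/negP: t'f; apply: (connect_facet fF tf).
  by apply: (@same_sheet_connect _ _ v); apply: sheet; apply: star_v.
have [[s sa ts] _] := sheets t (star_v _ tF vt).
have : [set v; a] \in singular_at F v by rewrite vE !inE eqxx.
rewrite inE => /andP[va _]; exists [set v; a]; split; rewrite ?set21 //.
exists s; first exact: (connect_facet fF tf (same_sheet_connect ts)).
by move: sa; rewrite in_star => /andP[].
Qed.

(** A singular vertex has exactly two singular edges; meeting at [v], they are adjacent and lie in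
    the same circle. *)
Lemma circle_degree C e v : C \in circles F -> e \in C -> v \in e ->
  #|[set e' in C | v \in e']| = 2%N.
Proof.
move=> CF eC ve.
have Cs e' : e' \in C -> e' \in singular_edges F.
  by rewrite (circleP _ CF eC) => /andP[].
have es := Cs _ eC.
have vF : v \in cover (triangles F).
  move: es; rewrite in_singular => /andP[+ _]; rewrite in_edges => /andP[+ _].
  by case/facesP=> _ [t tF et]; apply/bigcupP; exists t => //; apply: (subsetP et).
have sing : e \in singular_at F v by rewrite inE es.
case: (foam_vertices foam vF) => [[v0 _]|[a [b [ab vE _]]]].
  by rewrite v0 inE in sing.
have -> : [set e' in C | v \in e'] = singular_at F v.
  apply/setP=> e'; rewrite [LHS]in_set [RHS]in_set.
  case: (boolP (v \in e')) => ve'; rewrite ?andbF ?andbT //.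
  apply/idP/idP => [/Cs //|e's'].
  rewrite (circleP _ CF eC) e's' andbT; apply/connect1; rewrite /circle_adj es e's' /=.
  by rewrite -setI_eq0; apply/set0Pn; exists v; rewrite inE ve.
rewrite vE cards2; suff -> : [set v; a] != [set v; b] by [].
apply: contraNneq ab => E.
have : [set v; a] \in singular_at F v by rewrite vE !inE eqxx.
rewrite inE => /andP[/singular_card + _]; rewrite cards2 => va.
have : a \in [set v; b] by rewrite -E !inE eqxx orbT.
by rewrite !inE => /orP[/eqP av|/eqP->] //; rewrite av eqxx in va.
Qed.

Lemma euler_circle C : C \in circles F -> euler (faces C) = 0.
Proof.
move=> CF.
have C2 e : e \in C -> #|e| = 2%N.
  move=> eC; apply: (@singular_card _ F).
  by move: (eC); rewrite (circleP _ CF eC) => /andP[].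
(* Incidences are counted in two ways: each vertex lies on two edges and each edge has two
   vertices. *)
have handshake : (#|cover C| * 2 = #|C| * 2)%N.
  rewrite -[RHS]sum_nat_const -[LHS]sum_nat_const.
  transitivity (\sum_(v in cover C) \sum_(e in C | v \in e) 1)%N.
    apply: eq_bigr => v /bigcupP[e eC ve].
    rewrite sum1dep_card -(circle_degree CF eC ve).
    by apply: eq_card => e'; rewrite !inE.
  rewrite (exchange_big_dep (mem C)) //=; last by move=> v e _ /andP[].
  apply: eq_bigr => e eC; rewrite -(C2 e eC) -sum1_card; apply: eq_bigl => v.
  rewrite eC /=; apply/andP/idP => [[]//|ve]; split=> //.
  by apply/bigcupP; exists e.
rewrite /euler (bigID (mem C)) /=.
have -> : \sum_(s in faces C | s \in C) (-1) ^+ #|s|.-1 = - #|C|%:Z.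
  rewrite (eq_bigl (mem C)); last first.
    move=> e; rewrite /= andbC; apply/andP/idP => [[]//|eC]; split=> //.
    by apply/facesP; rewrite -card_gt0 (C2 e eC); split=> //; exists e.
  rewrite (eq_bigr (fun=> -1)); last by move=> e /= /C2->.
  by rewrite sumr_const mulNrn natz.
have -> : \sum_(s in faces C | s \notin C) (-1) ^+ #|s|.-1 = #|cover C|%:Z.
  rewrite (eq_bigl (mem [set [set v] | v in cover C])); last first.
    move=> s; rewrite /=; apply/andP/imsetP => [[/facesP[s0 [e eC se]] sC]|[v /bigcupP[e eC ve] ->]].
      have /cards1P[v sE] : #|s| == 1%N.
        have se' : s \proper e.
          by rewrite properEneq se andbT; apply: contraNneq sC => ->.
        by rewrite eqn_leq card_gt0 s0 andbT -ltnS -(C2 e eC) proper_card.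
      exists v => //; apply/bigcupP; exists e => //.
      by apply: (subsetP se); rewrite sE set11.
    split; last by apply/negP => /C2; rewrite cards1.
    apply/facesP; split; first by rewrite -card_gt0 cards1.
    by exists e; rewrite ?sub1set.
  rewrite (eq_bigr (fun=> 1)); last by move=> s /imsetP[v _ ->]; rewrite cards1.
  by rewrite sumr_const card_imset ?natz //; apply: set1_inj.
move: handshake => /eqP; rewrite eqn_pmul2r // => /eqP->.
by rewrite addNr.
Qed.

End FoamFacets.

(** * Disk flipping *)

Lemma facesU (T : finType) (X Y : {set {set T}}) :
  faces (X :|: Y) = faces X :|: faces Y.
Proof.
apply/setP=> s; rewrite [RHS]inE; apply/facesP/orP => [[s0 [t]]|].
  by rewrite inE => /orP[] tX st; [left|right]; apply/facesP; split=> //; exists t.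
by case=> /facesP[s0 [t tX st]]; split=> //; exists t; rewrite // inE tX ?orbT.
Qed.

(** In [positive_C], [X] and [Y] say which thin triangle is met first, and [a], [b] are the two
    colors. As the colors differ, negating both premises negates the conjunction, whatever the
    relation between [X] and [Y]. *)
Lemma impl_compl (X Y a b : bool) : a != b ->
  ((~~ X -> a) /\ (~~ Y -> b)) <-> ~ ((X -> a) /\ (Y -> b)).
Proof.
by case: X; case: Y; case: a; case: b => //= _; rewrite /is_true; intuition congruence.
Qed.

(* The suffix 1 marks statements about F1. *)
Section Flip.
Variables (R : realType) (T : finType) (pos : T -> 'rV[R]_3).
Variables (F F1 : prefoam T) (D C S : {set {set T}}).
Hypotheses (F_foam : is_foam pos F) (D_double : D \in double_facets F)
  (D_disk : is_disk (faces D)) (C_circle : C \in circles F)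
  (C_bounds_D : forall e, e \in singular_edges F ->
     (e \in C) = [exists t in D, e \subset t])
  (S_completes_D : completes_disk pos F D C S)
  (F1_foam : is_foam pos F1) (F1_flip : disk_flip F D S F1).
Implicit Types (s t e : {set T}).

(** * How the sphere meets the foam *)

Lemma D_facet : D \in facets F.
Proof. by move: D_double; rewrite inE => /andP[]. Qed.

Lemma D_triangles t : t \in D -> t \in triangles F.
Proof. exact: facet_triangles D_facet. Qed.

Lemma D_thin t : t \in D -> t \notin thin F.
Proof. by move: D_double; rewrite inE => /andP[_ /disjointFr H] /H->. Qed.

Lemma thin_D t : t \in thin F -> t \notin D.
Proof. by apply: contraL => /D_thin. Qed.

Lemma S_triangle t : t \in S -> #|t| = 3%N.
Proof. exact: (sphere_triangles S_completes_D). Qed.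

Lemma D_S t : t \in D -> t \in S.
Proof. exact: (subsetP (sphere_disk S_completes_D)). Qed.

Lemma D_neq0 : D != set0.
Proof.
have /and3P[_ _ D0] := facets_partition F.
by apply: contraNneq D0 => <-; apply: D_facet.
Qed.

Lemma faces_set0 (X : {set {set T}}) : set0 \notin faces X.
Proof. by rewrite in_faces eqxx. Qed.

Lemma faces_neq0 (X : {set {set T}}) :
  (forall t, t \in X -> #|t| = 3%N) -> X != set0 -> faces X != set0.
Proof.
move=> X3 /set0Pn[t tX]; apply/set0Pn; exists t; apply/facesP; split; last by exists t.
by rewrite -card_gt0 X3.
Qed.

(* The barycenter of s lies in D, hence in a simplex of D, which has to contain s
   as the barycenter is in no proper face. *)
Lemma faces_meet s : s \in faces S -> s \in faces (triangles F) -> s \in faces D.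
Proof.
move=> sS sF; have s0 : s != set0 by case/facesP: sS.
have [||r rD hr] := @sphere_meets _ _ _ _ _ _ _ S_completes_D (barycenter pos s).
- by exists s; last exact: hull_barycenter.
- by exists s; last exact: hull_barycenter.
have [r0 [t tD rt]] := facesP _ _ rD.
have rF : r \in faces (triangles F).
  by apply/facesP; split=> //; exists t => //; apply: D_triangles.
have sr := barycenter_sub (foam_embedded F_foam) sF rF s0 hr.
by apply/facesP; split=> //; exists t; rewrite // (subset_trans sr).
Qed.

Lemma faces_top (X : {set {set T}}) t : (forall s, s \in X -> #|s| = 3%N) ->
  t \in faces X -> #|t| = 3%N -> t \in X.
Proof.
move=> X3 /facesP[_ [s sX ts]] t3; suff -> : t = s by [].
by apply/eqP; rewrite eqEcard ts t3 X3.
Qed.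

Lemma mem_faces (X : {set {set T}}) s t :
  s != set0 -> t \in X -> s \subset t -> s \in faces X.
Proof. by move=> s0 tX st; apply/facesP; split=> //; exists t. Qed.

Lemma S_meet_triangle t : t \in S -> t \in triangles F -> t \in D.
Proof.
move=> tS tF; have t3 := S_triangle tS; have t0 : t != set0 by rewrite -card_gt0 t3.
apply: faces_top t3; first by move=> s /D_S/S_triangle.
by apply: faces_meet; apply: mem_faces (subxx t).
Qed.

Lemma in_triangles1 t : (t \in triangles F1) =
  (t \in triangles F) && (t \notin D) || (t \in S) && (t \notin D).
Proof. by rewrite (flip_triangles F1_flip) !inE !(andbC (t \notin D)). Qed.

Lemma thin1 : thin F1 = thin F.
Proof. exact: flip_thin F1_flip. Qed.

Lemma surface_S : is_surface (faces S).
Proof.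
apply: is_surface_sphere (sphere_sphere S_completes_D); last exact: faces_set0.
apply: faces_neq0 => [t /S_triangle //|].
by have [t tD] := set0Pn _ D_neq0; apply/set0Pn; exists t; apply: D_S.
Qed.

Lemma over_S e : triangles_over (faces S) e = [set t in S | e \subset t].
Proof.
apply/setP=> t; rewrite in_triangles_over [RHS]in_set.
apply/and3P/andP => [[tS /eqP t3 et]|[tS et]].
  by split=> //; apply: faces_top t3 => // s /S_triangle.
have t3 := S_triangle tS; rewrite t3; split=> //.
by apply: mem_faces tS (subxx t); rewrite -card_gt0 t3.
Qed.

(** Across a regular edge the second triangle would belong to the facet [D] too. *)
Lemma edge_DB e t t' : #|e| = 2%N -> t \in D -> e \subset t ->
  t' \in triangles F -> t' \notin D -> e \subset t' -> e \in C.
Proof.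
move=> e2 tD et t'F t'D et'; have tF := D_triangles tD.
have ts : t \in star F e by rewrite in_star tF.
case/orP: (foam_edges F_foam (edge_star e2 ts)) => [er|es].
  case/negP: t'D; apply: (connect_facet D_facet tD); apply/connect1/facet_adjP.
  by exists e => //; rewrite ts in_star t'F.
by rewrite C_bounds_D //; apply/existsP; exists t; rewrite tD.
Qed.

Lemma C_singular e : e \in C -> e \in singular_edges F.
Proof. by move=> eC; have := eC; rewrite (circleP _ C_circle eC) => /andP[]. Qed.

Lemma C_card e : e \in C -> #|e| = 2%N.
Proof. by move/C_singular/singular_card. Qed.

(** Of the three triangles at a singular edge two are thin, which leaves only the one of [D]. *)
Lemma C_disk_triangle e : e \in C -> exists2 d, d \in D & star F e :\: thin F = [set d].
Proof.
move=> eC; have es := C_singular eC.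
move: (eC); rewrite C_bounds_D // => /existsP[d /andP[dD ed]].
exists d => //; apply/eqP; rewrite eq_sym eqEcard sub1set.
rewrite in_setD D_thin // in_star D_triangles // ed cards1 cardsD.
rewrite (foam_singular_edges F_foam es); move: es; rewrite in_singular => /andP[_ /eqP->].
by [].
Qed.

(** The edge lies in exactly two triangles of the closed surface [S], one of which is the triangle
    of [D]. *)
Lemma C_new_triangle e : e \in C ->
  exists2 n, n \in S :\: D & [set t in S :\: D | e \subset t] = [set n].
Proof.
move=> eC; have [d dD dE] := C_disk_triangle eC.
have ed : e \subset d by have := set11 d; rewrite -dE in_setD in_star => /and3P[].
have [_ /(_ e (C_card eC)) S2 _] := surface_S; rewrite over_S in S2.
have D1 : [set t in S | e \subset t] :&: D = [set d].
  apply/setP=> t; rewrite in_setI !inE; apply/andP/eqP => [[/andP[tS et] tD]|->].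
    apply/set1P; rewrite -dE in_setD D_thin // in_star D_triangles //.
  by rewrite D_S // ed dD.
have N1 : [set t in S | e \subset t] :\: D = [set t in S :\: D | e \subset t].
  by apply/setP=> t; rewrite !inE andbA.
have := cardsID D [set t in S | e \subset t]; rewrite D1 N1 cards1 => cE.
have /eqP/cards1P[n nE] : #|[set t in S :\: D | e \subset t]| = 1%N.
  by case: S2 => S2; move: cE; rewrite S2 // add1n => -[].
by exists n => //; have := set11 n; rewrite -nE inE => /andP[].
Qed.

(** By [faces_meet] such an edge belongs to [D] as well, which reduces the claim to [edge_DB]. *)
Lemma edge_NB e t t' : #|e| = 2%N -> t \in S -> e \subset t ->
  t' \in triangles F -> t' \notin D -> e \subset t' -> e \in C.
Proof.
move=> e2 tS et t'F t'D et'; have e0 : e != set0 by rewrite -card_gt0 e2.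
have /facesP[_ [s sD es]] : e \in faces D.
  by apply: faces_meet; [apply: mem_faces tS et|apply: mem_faces t'F et'].
exact: edge_DB sD es t'F t'D et'.
Qed.

(** A triangle removed or added at [e] by the flip would force [e] into [C], by [edge_DB] and
    [edge_NB]. *)
Lemma star1 e t : #|e| = 2%N -> e \notin C -> t \in triangles F -> t \notin D ->
  e \subset t -> star F1 e = star F e.
Proof.
move=> e2 eC tF tD et; apply/setP=> u; rewrite !in_star in_triangles1.
have [eu|_] := boolP (e \subset u); rewrite ?andbF // !andbT.
have [uD|uD] := boolP (u \in D); rewrite ?andbF ?andbT /=.
  by case/negP: eC; apply: edge_DB e2 uD eu tF tD et.
case: (boolP (u \in S)) => [uS|_]; rewrite ?orbF //.
by case/negP: eC; apply: edge_NB e2 uS eu tF tD et.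
Qed.

Lemma singular_thin (G : prefoam T) e : is_foam pos G -> e \in singular_edges G ->
  exists t u, [/\ t != u, star G e :&: thin G = [set t; u],
     [/\ t \in thin G & u \in thin G] & [/\ e \subset t & e \subset u]].
Proof.
move=> Gf es; have /eqP/cards2P[t [u [tu E]]] := foam_singular_edges Gf es.
exists t, u; split=> //; have := set21 t u; have := set22 t u; rewrite -E !in_setI !in_star.
  by move=> /andP[_ ->] /andP[_ ->].
by move=> /andP[/andP[_ ->] _] /andP[/andP[_ ->] _].
Qed.

(** A singular edge of either foam lies on a thin triangle, which survives the flip and so makes
    [star1] applicable off [C]. *)
Lemma singular1 : singular_edges F1 = singular_edges F.
Proof.
apply/setP=> e; apply/idP/idP => es.
  have [t [_ [_ _ [tthin _] [et _]]]] := singular_thin F1_foam es; rewrite thin1 in tthin.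
  have [/C_singular //|eC] := boolP (e \in C).
  have tF := thinF F_foam tthin; have e2 := singular_card es.
  have te : t \in star F e by rewrite in_star tF.
  rewrite in_singular (edge_star e2 te) -(star1 e2 eC tF (thin_D tthin) et).
  by move: es; rewrite in_singular => /andP[].
have [t [_ [_ _ [tthin _] [et _]]]] := singular_thin F_foam es.
have tF := thinF F_foam tthin; have e2 := singular_card es.
have te : t \in star F1 e by rewrite in_star in_triangles1 tF thin_D.
have eE := edge_star e2 te.
have [eC|eC] := boolP (e \in C); last first.
  rewrite in_singular eE (star1 e2 eC tF (thin_D tthin) et).
  by move: es; rewrite in_singular => /andP[].
(* At a regular edge the new triangle [n] would be thin like [t], hence a triangle of both [S] and
   [F], and so of [D]. *)
case/orP: (foam_edges F1_foam eE) => // er.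
have [n nN nE] := C_new_triangle eC.
have en : e \subset n by have := set11 n; rewrite -nE inE => /andP[].
move: nN; rewrite inE => /andP[nD nS].
have ne : n \in star F1 e by rewrite in_star in_triangles1 nS nD orbT.
have := foam_regular_edges F1_foam er te ne; rewrite thin1 tthin => /esym/(thinF F_foam).
by move/(S_meet_triangle nS); rewrite (negPf nD).
Qed.

(** * Facets, circles and colorings after the flip *)

Lemma regular1 e t : t \in triangles F -> t \notin D -> e \subset t ->
  (e \in regular_edges F1) = (e \in regular_edges F).
Proof.
move=> tF tD et; have t1 : t \in triangles F1 by rewrite in_triangles1 tF tD.
have [e2|e2] := eqVneq #|e| 2%N; last first.
  by apply/idP/idP => /regular_card/eqP; rewrite (negPf e2).
have eE : e \in edges F by apply: (@edge_star _ _ _ t e2); rewrite in_star tF.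
have eE1 : e \in edges F1 by apply: (@edge_star _ _ _ t e2); rewrite in_star t1.
apply/idP/idP => er.
  have eC : e \notin C.
    by apply/negP => /C_singular; rewrite -singular1; apply/negP; apply: regular_not_singular.
  by move: er; rewrite !in_regular eE eE1 (star1 e2 eC tF tD et).
have eC : e \notin C.
  by apply/negP => /C_singular; apply/negP; apply: regular_not_singular.
by move: er; rewrite !in_regular eE eE1 (star1 e2 eC tF tD et).
Qed.

Lemma regular_notC e : e \in regular_edges F -> e \notin C.
Proof. by move/regular_not_singular; apply: contra => /C_singular. Qed.

Lemma facet_adj1 s t : s \in triangles F -> s \notin D ->
  facet_adj F1 s t = facet_adj F s t.
Proof.
move=> sF sD; apply/facet_adjP/facet_adjP => -[e er [se te]];
  have es : e \subset s by move: se; rewrite in_star => /andP[].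
  rewrite (regular1 sF sD es) in er; exists e => //.
  by rewrite -(star1 (regular_card er) (regular_notC er) sF sD es).
exists e; first by rewrite (regular1 sF sD es).
by rewrite (star1 (regular_card er) (regular_notC er) sF sD es).
Qed.

Lemma facet_adjB s t : s \in triangles F -> s \notin D -> facet_adj F s t ->
  t \in triangles F /\ t \notin D.
Proof.
move=> sF sD st; split.
  by move: st => /facet_adjP[e _ [_]]; rewrite in_star => /andP[].
apply: contra sD => tD; apply: (connect_facet D_facet tD).
by rewrite facet_adj_sym connect1.
Qed.

(** The triangles off [D] are closed under adjacency, [D] being a whole facet, and on them the
    adjacencies of the two foams agree. *)
Lemma facet_of1 t : t \in triangles F -> t \notin D -> facet_of F1 t = facet_of F t.
Proof.
move=> tF tD; have t1 : t \in triangles F1 by rewrite in_triangles1 tF tD.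
rewrite !facet_ofE //; apply/setP=> s; rewrite !inE.
have to1 : connect (facet_adj F) t s ->
    [/\ s \in triangles F, s \notin D & connect (facet_adj F1) t s].
  move: s; apply: connect_ind => // s u su [sF sD ts].
  have [uF uD] := facet_adjB sF sD su; split=> //.
  by apply: connect_trans ts (connect1 _); rewrite facet_adj1.
have from1 : connect (facet_adj F1) t s ->
    [/\ s \in triangles F, s \notin D & connect (facet_adj F) t s].
  move: s {to1}; apply: connect_ind => // s u + [sF sD ts]; rewrite facet_adj1 // => su.
  have [uF uD] := facet_adjB sF sD su; split=> //.
  exact: connect_trans ts (connect1 su).
apply/andP/andP => -[_]; first by move/from1=> [-> _ ->].
by move/to1=> [sF sD ->]; rewrite in_triangles1 sF sD.
Qed.

Lemma facet_of_thin1 t : t \in thin F -> facet_of F1 t = facet_of F t.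
Proof. by move=> tthin; rewrite facet_of1 ?thin_D // (thinF F_foam). Qed.

Lemma thin_facets1 : thin_facets F1 = thin_facets F.
Proof.
apply/setP=> f; apply/(thin_facetsP F1_foam)/(thin_facetsP F_foam) => -[t tthin ->].
  by rewrite thin1 in tthin; exists t; rewrite ?facet_of_thin1.
by exists t; rewrite ?thin1 ?facet_of_thin1.
Qed.

Lemma circles1 : circles F1 = circles F.
Proof.
by rewrite /circles /circle_adj singular1. Qed.

Lemma star_thin1 e : star F1 e :&: thin F1 = star F e :&: thin F.
Proof.
apply/setP=> t; rewrite thin1 !in_setI !in_star in_triangles1.
have [tthin|] := boolP (t \in thin F); rewrite ?andbF // !andbT.
by rewrite (thinF F_foam) // thin_D.
Qed.

Lemma is_coloring1 c : is_coloring F1 c = is_coloring F c.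
Proof.
rewrite /is_coloring thin_facets1 singular1; congr (_ && _).
apply: eq_forallb => e; congr (_ ==> _); rewrite star_thin1.
apply: eq_forallb => s; have [|//] := boolP (s \in _); rewrite in_setI => /andP[_ sthin].
apply: eq_forallb => t; have [|//] := boolP (t \in _); rewrite in_setI => /andP[_ tthin].
by rewrite !facet_of_thin1.
Qed.

Lemma coloring_thin c e t u : is_coloring F c -> e \in singular_edges F ->
  t \in star F e :&: thin F -> u \in star F e :&: thin F -> t != u ->
  c (facet_of F t) != c (facet_of F u).
Proof.
case/andP=> _ /forall_inP/(_ e)/[apply]/forall_inP/(_ t)/[apply]/forall_inP/(_ u)/[apply].
by move/implyP.
Qed.

Lemma ndots1 c i : ndots F1 c i = ndots F c i.
Proof.
rewrite /ndots thin_facets1; apply: eq_bigr => f /andP[fthin _].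
exact: flip_dots F1_flip _ fthin.
Qed.

(** * Euler characteristics of the colored surfaces *)

Section EulerCharacteristics.
Variables (c : {ffun {set {set T}} -> bool}) (i : bool).
Hypothesis c_coloring : is_coloring F c.

(** The part of the colored surface that the flip leaves in place. *)
Definition common : {set {set T}} :=
  [set t in triangles F :\: D | (t \notin thin F) || (c (facet_of F t) == i)].

Lemma common_triangles t : t \in common -> t \in triangles F /\ t \notin D.
Proof. by rewrite !inE => /andP[/andP[]]. Qed.

Lemma colored_surfaceE : colored_surface F c i = faces (common :|: D).
Proof.
rewrite /colored_surface (colored_coverE F_foam); congr faces; apply/setP=> t; rewrite !inE.
have [tD|tD] := boolP (t \in D); rewrite ?orbT ?orbF //=.
by rewrite D_triangles // D_thin.
Qed.

Lemma colored_surfaceE1 : colored_surface F1 c i = faces (common :|: (S :\: D)).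
Proof.
rewrite /colored_surface (colored_coverE F1_foam); congr faces; apply/setP=> t.
rewrite thin1 !inE in_triangles1; have [tD|tD] := boolP (t \in D);
  rewrite ?andbF //= !andbT.
have [tF|tF] := boolP (t \in triangles F) => /=.
  rewrite facet_of1 //; have [tS|_] := boolP (t \in S); last by rewrite orbF.
  by case/negP: tD; apply: S_meet_triangle.
have -> : t \notin thin F by apply: contra tF => /(thinF F_foam).
by rewrite andbT.
Qed.

Lemma faces_common s : s \in faces common -> s \in faces (triangles F).
Proof.
case/facesP=> s0 [t /common_triangles[tF _] st]; exact: mem_faces tF st.
Qed.

(** For [common]: the two thin triangles at [e] are colored differently, so one of them has color
    [i]. *)
Lemma C_faces s e : s != set0 -> s \subset e -> e \in C ->
  [/\ s \in faces common, s \in faces D & s \in faces (S :\: D)].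
Proof.
move=> s0 se eC; have es := C_singular eC; split.
- have [t [u [tu tuE [tthin uthin] [et eu]]]] := singular_thin F_foam es.
  have := coloring_thin c_coloring es; rewrite tuE => /(_ t u (set21 _ _) (set22 _ _) tu) ctu.
  have [x [xthin ex cx]] : exists x, [/\ x \in thin F, e \subset x & c (facet_of F x) == i].
    have [ct|ct] := eqVneq (c (facet_of F t)) i; first by exists t; rewrite ct.
    by exists u; split=> //; move: ctu ct; case: (c _); case: (c _); case: (i).
  apply: (mem_faces s0 (t := x)); last exact: subset_trans ex.
  by rewrite !inE thin_D // (thinF F_foam) // cx orbT.
- have := eC; rewrite C_bounds_D // => /existsP[t /andP[tD et]].
  by apply: mem_faces tD _; rewrite ?(subset_trans se).
have [n nN nE] := C_new_triangle eC; apply: mem_faces nN _ => //.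
by apply: subset_trans se _; have := set11 n; rewrite -nE inE => /andP[].
Qed.

Lemma small_simplex (X : {set {set T}}) s t : (forall u, u \in X -> #|u| = 3%N) ->
  s != set0 -> t \in X -> s \subset t -> [\/ s = t, #|s| = 2%N | exists v, s = [set v]].
Proof.
move=> X3 s0 tX st; have := subset_leq_card st; rewrite (X3 t tX).
case s3: #|s| => [|[|[|[|]]]] // _.
- by rewrite -cards_eq0 s3 in s0.
- by have /eqP/cards1P[v ->] := s3; constructor 3; exists v.
- by constructor 2.
- by constructor 1; apply/eqP; rewrite eqEcard st s3 (X3 t tX).
Qed.

(** A common edge is settled by [edge_DB]. At a common vertex two facets meet, so [vertex_between]
    provides a singular edge of [D] through it. *)
Lemma faces_common_D s : s \in faces common -> s \in faces D -> s \in faces C.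
Proof.
case/facesP=> s0 [t tX st] /facesP[_ [u uD su]]; have [tF tD] := common_triangles tX.
have D3 d : d \in D -> #|d| = 3%N by move/D_S/S_triangle.
case: (small_simplex D3 s0 uD su) => [E|s2|[v E]].
- case/negP: tD; suff <- : s = t by rewrite E.
  by apply/eqP; rewrite eqEcard st (tri3 F_foam tF) E D3.
- by apply: (mem_faces s0 _ (subxx s)); apply: edge_DB su tF tD st.
move: st su; rewrite E !sub1set => vt vu.
have [e [es ve [d dD ed]]] := vertex_between F_foam D_facet uD tF tD vu vt.
apply: (mem_faces (t := e)); rewrite ?sub1set -?card_gt0 ?cards1 //.
by rewrite C_bounds_D //; apply/existsP; exists d; rewrite dD.
Qed.

Lemma faces_DN s : s \in faces D -> s \in faces (S :\: D) -> s \in faces C.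
Proof.
case/facesP=> s0 [t tD st] /facesP[_ [n nN sn]].
have [nD nS] : n \notin D /\ n \in S by move: nN; rewrite inE => /andP[].
have [dimS S2 Slink] := surface_S.
have edge e d n' : #|e| = 2%N -> d \in D -> e \subset d -> n' \in S -> n' \notin D ->
    e \subset n' -> e \in C.
  move=> e2 dD ed n'S n'D en'.
  have dF : d \in star F e by rewrite in_star D_triangles.
  have eE := edge_star e2 dF; case/orP: (foam_edges F_foam eE) => er; last first.
    by rewrite C_bounds_D //; apply/existsP; exists d; rewrite dD.
  (* A regular edge already has two triangles in [D], so [n'] would be a third one in [S]. *)
  have sub : n' |: star F e \subset [set u in S | e \subset u].
    apply/subsetP => u; rewrite in_setU1 in_set => /orP[/eqP->|ue]; first by rewrite n'S.
    have -> : e \subset u by move: ue; rewrite in_star => /andP[].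
    rewrite andbT; apply: D_S; apply: (connect_facet D_facet dD).
    by apply/connect1/facet_adjP; exists e.
  have := subset_leq_card sub; rewrite cardsU1.
  have -> : n' \notin star F e.
    by apply: contra n'D; rewrite in_star => /andP[/(S_meet_triangle n'S)].
  have := er; rewrite in_regular -over_S => /andP[_ /eqP->].
  by case: (S2 e e2) => ->.
have D3 d : d \in D -> #|d| = 3%N by move/D_S/S_triangle.
case: (small_simplex D3 s0 tD st) => [E|s2|[v E]].
- case/negP: nD; suff <- : s = n by rewrite E.
  by apply/eqP; rewrite eqEcard sn (S_triangle nS) E D3.
- by apply: (mem_faces s0 _ (subxx s)); apply: edge tD st nS nD sn.
have [|noC] := boolP [exists e in C, v \in e].
  by case/existsP=> e /andP[eC ve]; rewrite E; apply: mem_faces eC _; rewrite -?E // E sub1set.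
move: st sn; rewrite E => vt vn.
suff : (t \in D) = (n \in D) by rewrite tD (negPf nD).
(* Off [C] no edge at [v] separates [D] from [S :\: D], so membership in [D] is constant on the
   triangles of [S] at [v]. *)
apply: (Slink v (mem D)); rewrite ?over_S ?inE ?vt ?vn ?nS ?D_S // => x t1 t2 xv.
rewrite !over_S !in_set => /andP[t1S xt1] /andP[t2S xt2].
have vx2 : #|[set v; x]| = 2%N by rewrite cards2 eq_sym xv.
have vxC : [set v; x] \notin C.
  by apply: contra noC => vxC; apply/existsP; exists [set v; x]; rewrite vxC set21.
rewrite /=; have [t1D|t1D] := boolP (t1 \in D); have [t2D|t2D] := boolP (t2 \in D) => //.
  by case/negP: vxC; apply: edge t1D xt1 t2S t2D xt2.
by case/negP: vxC; apply: edge t2D xt2 t1S t1D xt1.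
Qed.

Lemma faces_C s : s \in faces C ->
  [/\ s \in faces common, s \in faces D & s \in faces (S :\: D)].
Proof. by case/facesP=> s0 [e eC se]; apply: C_faces se eC. Qed.

Lemma faces_common_N s : s \in faces common -> s \in faces (S :\: D) -> s \in faces C.
Proof.
move=> sX sN; apply: faces_common_D => //; apply: faces_meet; last exact: faces_common.
by case/facesP: sN => s0 [t]; rewrite inE => /andP[_ tS]; apply: mem_faces.
Qed.

Lemma chi1 : chi F1 c i = chi F c i.
Proof.
rewrite /chi colored_surfaceE colored_surfaceE1 !facesU !euler_setU.
have -> : faces common :&: faces D = faces C.
  apply/setP=> s; rewrite in_setI; apply/andP/idP => [[]|/faces_C[]] //.
  exact: faces_common_D.
have -> : faces common :&: faces (S :\: D) = faces C.
  apply/setP=> s; rewrite in_setI; apply/andP/idP => [[]|/faces_C[]] //.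
  exact: faces_common_N.
have D3 d : d \in D -> #|d| = 3%N by move/D_S/S_triangle.
have eD := euler_disk (faces_neq0 D3 D_neq0) (faces_set0 D) D_disk.
have eS S0 := euler_sphere (faces_neq0 S_triangle S0) (faces_set0 S)
  (sphere_sphere S_completes_D).
have SE : D :|: (S :\: D) = S.
  apply/setP=> t; rewrite !inE; case: (boolP (t \in D)) => [/D_S->|] //.
have DN : faces D :&: faces (S :\: D) = faces C.
  apply/setP=> s; rewrite in_setI; apply/andP/idP => [[]|/faces_C[]] //.
  exact: faces_DN.
have S0 : S != set0.
  by have [t tD] := set0Pn _ D_neq0; apply/set0Pn; exists t; apply: D_S.
have := eS S0; rewrite -{1}SE facesU euler_setU DN (euler_circle F_foam C_circle) eD.
lia.
Qed.

End EulerCharacteristics.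

(** * The change of sign *)

Lemma ori1 p q a : [set p; q; a] \in thin F -> ori F1 p q a = ori F p q a.
Proof.
by move=> pqa; apply: (flip_ori F1_flip); rewrite inE thin_D // (thinF F_foam).
Qed.

Lemma pos_edge1 c e : e \in singular_edges F -> e \notin C ->
  pos_edge pos F1 c e <-> pos_edge pos F c e.
Proof.
move=> es eC.
have [t [_ [_ _ [tthin _] [et _]]]] := singular_thin F_foam es.
have starE := star1 (singular_card es) eC (thinF F_foam tthin) (thin_D tthin) et.
have triE p q u : e = [set p; q] ->
    ([set p; q; u] \in triangles F1) = ([set p; q; u] \in triangles F).
  by move=> eE; move/setP/(_ [set p; q; u]): starE; rewrite !in_star eE subsetUl !andbT.
split=> H p q eE d a b; have := H p q eE d a b;
  rewrite thin1 !in_setD (triE _ _ _ eE) => Hd pd pa pb ab o f.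
  by rewrite -facet_of_thin1 //; apply: Hd; rewrite ?ori1.
by rewrite facet_of_thin1 //; apply: Hd; rewrite -?ori1.
Qed.

Lemma positive1 c C' : C' \in circles F -> C' != C ->
  positive pos F1 c C' = positive pos F c C'.
Proof.
move=> C'F C'C; have /and3P[_ triv _] := circles_partition F.
have C'e e : e \in C' -> e \in singular_edges F /\ e \notin C.
  move=> eC'; split; first by have := eC'; rewrite (circleP _ C'F eC') => /andP[].
  have /trivIsetP/(_ _ _ C'F C_circle C'C) := triv.
  by move/disjointFr => ->.
by apply/positiveP/positiveP => H e eC'; have [es eC] := C'e _ eC';
  have [H1 H2] := pos_edge1 c es eC; [apply: H1|apply: H2]; apply: H.
Qed.

(** Both signs are read off at one edge [pq] of [C], where [pos_edge_iff] turns them into two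
    implications from cyclic order to color. By [sphere_side] the flip negates the premises, and
    [impl_compl] concludes. *)
Lemma positive_C c : is_coloring F c -> positive pos F1 c C = ~~ positive pos F c C.
Proof.
move=> c_col; have C1 : C \in circles F1 by rewrite circles1.
have /set0Pn[e eC] : C != set0.
  have /and3P[_ _ C0] := circles_partition F.
  by apply: contraNneq C0 => <-.
have es := C_singular eC.
have [t [u [tu tuE [tthin uthin] [et eu]]]] := singular_thin F_foam es.
have := coloring_thin c_col es; rewrite tuE => /(_ t u (set21 _ _) (set22 _ _) tu) ctu.
have [d dD dE] := C_disk_triangle eC; have [n nN nE] := C_new_triangle eC.
have ed : e \subset d by have := set11 d; rewrite -dE in_setD in_star => /and3P[].
have en : e \subset n by have := set11 n; rewrite -nE in_set => /andP[].
(* The ends are named along the orientation of the edge: exchanging [p] and [q] negates [ori]. *)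
have [p [q [a [eE tE o]]]] : exists p q a,
    [/\ e = [set p; q], t = [set p; q; a] & ori F p q a].
  have /eqP/cards2P[p [q [pq eE]]] := singular_card es.
  have [|a tE tF] := @tri_split _ _ _ _ F_foam p q t pq.
    by rewrite -eE in_star et (thinF F_foam).
  have [o|o] := boolP (ori F p q a); first by exists p, q, a.
  exists q, p, a; split; [by rewrite setUC|by rewrite set3C12|].
  by rewrite (ori_swap12 F_foam tF) o.
have pq : p != q by have := singular_card es; rewrite eE cards2; case: (p != q).
have [|b uE uF] := @tri_split _ _ _ _ F_foam p q u pq.
  by rewrite -eE in_star eu (thinF F_foam).
have [|d0 dE0 _] := @tri_split _ _ _ _ F_foam p q d pq.
  by rewrite -eE in_star ed D_triangles.
have [|n0 nE0 _] := @tri_split _ _ _ _ F1_foam p q n pq.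
  by move: nN; rewrite -eE in_star en in_triangles1 inE => /andP[-> ->]; rewrite orbT.
have ab : a != b by apply: contraNneq tu => ab; rewrite tE uE ab.
have ba : b != a by rewrite eq_sym.
have pqs1 : [set p; q] \in singular_edges F1 by rewrite singular1 -eE.
rewrite eE in eC es; rewrite tE in tthin ctu; rewrite uE in uthin ctu.
rewrite dE0 in dD; rewrite nE0 in nN.
have dN : [set p; q; d0] \in triangles F :\: thin F by rewrite in_setD D_thin ?D_triangles.
have nN1 : [set p; q; n0] \in triangles F1 :\: thin F1.
  move: nN; rewrite !in_setD in_triangles1 thin1 => /andP[nD nS]; rewrite nS nD orbT andbT.
  by apply: contra nD => /(thinF F_foam)/(S_meet_triangle nS).
have eF := positive_edge F_foam c C_circle eC; have eF1 := positive_edge F1_foam c C1 eC.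
have iF := pos_edge_iff F_foam c es dN tthin uthin ab o.
have [|||iF1 iF1'] := pos_edge_iff F1_foam c pqs1 nN1 (a := a) (b := b) _ _ ab.
- by rewrite thin1.
- by rewrite thin1.
- by rewrite ori1.
rewrite !facet_of_thin1 // in iF1 iF1'.
have side x y : [set p; q; x] \in thin F -> [set p; q; y] \in thin F -> x != y ->
    first_ccw pos p q n0 x y = ~~ first_ccw pos p q d0 x y.
  move=> xt yt xy; have := sphere_side S_completes_D eC xt yt xy dD nN.
  by rewrite /first_ccw -!(rot_order_rot pos p q x); do 2!case: rot_order.
rewrite !side // in iF1 iF1'; case: iF => iF iF'.
have flip := impl_compl (first_ccw pos p q d0 a b) (first_ccw pos p q d0 b a) ctu.
apply/idP/negP => [/eF1/iF1/flip H /eF/iF //|H].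
by apply/eF1/iF1'/flip => /iF'/eF.
Qed.

(** [m] is the number of positive circles other than [C], the same for both foams. *)
Lemma theta1 c : is_coloring F c ->
  exists m, theta pos F c = (positive pos F c C + m)%N /\
            theta pos F1 c = (~~ positive pos F c C + m)%N.
Proof.
move=> c_col.
have other : [set C' in circles F1 | positive pos F1 c C'] :\ C =
             [set C' in circles F | positive pos F c C'] :\ C.
  apply/setP=> C'; rewrite [LHS]in_setD1 [RHS]in_setD1; apply: andb_id2l => C'C.
  rewrite [LHS]in_set [RHS]in_set circles1; apply: andb_id2l => C'F.
  exact: positive1 C'F C'C.
have [m mE] : exists m, m = #|[set C' in circles F | positive pos F c C'] :\ C|.
  by exists #|[set C' in circles F | positive pos F c C'] :\ C|.
exists m; rewrite /theta; split; first by rewrite (cardsD1 C) mE inE C_circle.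
have CE : (C \in [set C' in circles F1 | positive pos F1 c C']) = ~~ positive pos F c C.
  by rewrite in_set circles1 C_circle (positive_C c_col).
by rewrite (cardsD1 C) CE other -mE.
Qed.

Lemma color_eval1 c : is_coloring F c -> color_eval pos F1 c = - color_eval pos F c.
Proof.
move=> c_col; rewrite /color_eval !chi1 // !ndots1 /chi12 thin1.
have [m [-> ->]] := theta1 c_col.
rewrite -!mulNr; congr (_ * _ * _).
rewrite !exprzDr ?unitrN1 // !PoszD !exprzDr ?unitrN1 // -!mulNr; congr (_ * _ * _).
(* Exactly one of the two exponents contains the extra 1 coming from [C]. *)
by case: positive; rewrite ?opprK.
Qed.

End Flip.

Theorem proposition4p8 (R : realType) (T : finType) (pos : T -> 'rV[R]_3)
    (F F1 : prefoam T) (D C S : {set {set T}})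
    (F_foam : is_foam pos F)
    (D_double : D \in double_facets F)
    (D_disk : is_disk (faces D))
    (C_circle : C \in circles F)
    (C_bounds_D : forall e, e \in singular_edges F ->
       (e \in C) = [exists t in D, e \subset t])
    (S_completes_D : completes_disk pos F D C S)
    (F1_foam : is_foam pos F1)
    (F1_flip : disk_flip F D S F1) :
  foam_eval pos F = - foam_eval pos F1.
Proof.
rewrite /foam_eval -sumrN; apply: eq_big => [c|c c_col].
  exact/esym/(is_coloring1 F_foam D_double C_circle C_bounds_D S_completes_D
    F1_foam F1_flip).
by rewrite (color_eval1 F_foam D_double D_disk C_circle C_bounds_D S_completes_D
  F1_foam F1_flip) ?opprK.
Qed.
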